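(* \textsc{Diameter} can be solved in $O(h\cdot(m+n)+n\cdot d\cdot 2^{h\log d+d\log h})$ time, where $n,m$ are the numbers of vertices and edges, $d$ is the diameter and $h$ is the $h$-index of the input graph.
   Context: \textsc{Diameter}: given an undirected, connected, unweighted graph, compute its diameter (the length of a longest shortest path). The $h$-index of a graph $G$ is the largest integer $\ell$ such that $G$ contains at least $\ell$ vertices of degree at least $\ell$. *)

(* Defs.v *)
From mathcomp Require Import all_boot.
Set Implicit Arguments. Unset Strict Implicit. Unset Printing Implicit Defensive.

Definition simple_graph (n : nat) (e : rel 'I_n) : Prop :=
  symmetric e /\ irreflexive e.

Definition connected_graph (n : nat) (e : rel 'I_n) : Prop :=
  forall u v : 'I_n, connect e u v.

Definition deg (n : nat) (e : rel 'I_n) (v : 'I_n) : nat := #|[set w | e v w]|.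

Definition num_edges (n : nat) (e : rel 'I_n) : nat :=
  #|[set p : 'I_n * 'I_n | (p.1 < p.2)%N && e p.1 p.2]|.

Definition hindex (n : nat) (e : rel 'I_n) : nat :=
  \max_(l < n.+1 | l <= #|[set v | l <= deg e v]|) l.

Definition is_diameter (n : nat) (e : rel 'I_n) (d : nat) : Prop :=
  (forall u v : 'I_n, exists p : seq 'I_n,
      path e u p /\ last u p = v /\ size p <= d) /\
  (exists u v : 'I_n, forall p : seq 'I_n,
      path e u p -> last u p = v -> d <= size p).

(* Machine model: a unit-cost RAM with registers and memory indexed   *)
(* by nat, instructions with addition / truncated subtraction,        *)
(* indirect load/store and conditional jumps.  The word size is       *)
(* restricted in the theorem (values polynomially bounded).            *)
Inductive instr : Type :=
| IConst (r k : nat)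
| IAdd (r a b : nat)
| ISub (r a b : nat)
| ILoad (r a : nat)
| IStore (a r : nat)
| IJz (r l : nat)
| IJmp (l : nat)
| IHalt.

Definition program := seq instr.

Record state := St { pc : nat; reg : nat -> nat; mem : nat -> nat }.

Definition upd (f : nat -> nat) (a x : nat) : nat -> nat :=
  fun i => if i == a then x else f i.

Definition step (P : program) (s : state) : option state :=
  let: St p R M := s in
  match nth IHalt P p with
  | IConst r k => Some (St p.+1 (upd R r k) M)
  | IAdd r a b => Some (St p.+1 (upd R r (R a + R b)) M)
  | ISub r a b => Some (St p.+1 (upd R r (R a - R b)) M)
  | ILoad r a => Some (St p.+1 (upd R r (M (R a))) M)
  | IStore a r => Some (St p.+1 R (upd M (R a) (R r)))
  | IJz r l => Some (St (if R r == 0 then l else p.+1) R M)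
  | IJmp l => Some (St l R M)
  | IHalt => None
  end.

Fixpoint run (P : program) (t : nat) (s : state) : state :=
  if t is t'.+1 then
    match step P s with Some s' => run P t' s' | None => s end
  else s.

Definition halted (P : program) (s : state) : bool :=
  if step P s is None then true else false.

Definition init_state (input : seq nat) : state :=
  St 0 (fun _ => 0) (fun i => nth 0 input i).

Definition values_bounded (s : state) (W : nat) : Prop :=
  (forall r, reg s r <= W) /\ (forall i, mem s i <= W).

(* Input encoding: adjacency lists in compressed form.                 *)
(*   M[0] = n,                                                        *)
(*   M[1+v] = start address of the list of v (v = 0..n), with         *)
(*   M[1+n] = end of the last list,                                   *)
(*   then the neighbour lists of vertices 0,1,...,n-1 concatenated.   *)
Definition adj_lists_of (n : nat) (e : rel 'I_n) (L : 'I_n -> seq 'I_n) : Prop :=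
  forall v : 'I_n, uniq (L v) /\ (forall w, (w \in L v) = e v w).

Definition encode (n : nat) (L : 'I_n -> seq 'I_n) : seq nat :=
  let lens := [seq size (L v) | v <- enum 'I_n] in
  let starts := [seq n.+2 + sumn (take k lens) | k <- iota 0 n.+1] in
  n :: starts ++ flatten [seq [seq val w | w <- L v] | v <- enum 'I_n].

(* The time bound h(m+n) + n d 2^(h log d + d log h) = h(m+n) + n d d^h h^d *)
Definition time_bound (n m d h : nat) : nat :=
  h * (m + n) + n * d * (d ^ h * h ^ d).

(* Main.v *)
Require Import Defs.
From mathcomp Require Import all_boot zify.
Set Implicit Arguments. Unset Strict Implicit. Unset Printing Implicit Defensive.

(**
Let l be the least positive integer such that fewer than l vertices have degree
at least l; call those vertices hubs.  Then l - 1 <= h, so there are at most h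
hubs and every other vertex has degree at most h.  A full breadth-first search
from every hub costs O(h(m+n)).  Two vertices have the same type if they are at
the same distance from every hub; a non-hub has one of at most d^h types.

For k = 0, 1, ... test whether all distances are at most k.  A path of length at
most k from v to w either meets a hub x, and then d(v,x) + d(x,w) <= k, which
depends only on the type of w, or avoids all hubs, and then w is found by a
search of depth k from v outside the hubs, which meets O(k h^k) vertices.  So
it suffices to count, for each v, the vertices in types that are close to v
through a hub and the remaining vertices met by the local search.  The first
successful k is d, and the d + 1 rounds account for the factor d.  The polynomial
factors of a single test are absorbed by h <= h^d, d <= d^h, and h^2 <= h^d for
d >= 2, whereas there are no hubs if d = 1.
*)

(** * Structured programs on the RAM *)

(** The test for one vertex [v] must not take time proportional to [n], because it is repeated [n]
    times in every round. Hence the reached vertices are counted without being enumerated: a counter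
    starts at [n], the sizes of the types close to [v] are subtracted, then 1 for every vertex of
    the local search whose type was not counted, and [v] passes iff the counter ends at 0. For the
    same reason the marks of the local search are erased by walking along its queue. One search
    routine serves both purposes: with degree bound [n + 1] it excludes no vertex, with degree bound
    [l] it stays outside the hubs. The bound on all values is a separate obstacle. It does not
    follow from the time bound, since repeated additions could double a value at every step; it
    rests on a syntactic property of the finished program. *)

(* The memory behind the input is divided into rows of length n: row 0 is the
   queue, row 1 the marks of the local search, row 2 the type of each vertex,
   row 3 a representative and row 4 the size of each type, row 5 a flag for each
   type, and row 6 + x the distances from the x-th hub.  The registers [bQ], ...,
   [bD] hold the addresses of these rows, [rn] holds n, [rz] zero, and [rT] is
   used for addresses only. *)
Notation rk := 0.      Notation rn := 1.     Notation rone := 2.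
Notation rtwo := 3.    Notation rz := 4.
Notation bQ := 5.      Notation bM := 6.     Notation bT := 7.
Notation bR := 8.      Notation bC := 9.     Notation bG := 10.
Notation bD := 11.
Notation rl := 12.     Notation rnh := 13.   Notation rnt := 14.
Notation rv := 15.     Notation rth := 16.   Notation rlim := 17.
Notation rsrc := 18.   Notation rp := 19.    Notation rhead := 20.
Notation rtail := 21.  Notation rhi := 22.   Notation rlev := 23.
Notation ru := 24.     Notation rw := 25.    Notation ra := 26.
Notation rae := 27.    Notation rx := 28.    Notation ry := 29.
Notation rg := 30.     Notation rf := 31.    Notation rc := 32.
Notation ri := 33.     Notation rj := 34.    Notation rk2 := 35.
Notation rbad := 36.   Notation rrem := 37.  Notation rrep := 38.
Notation rd := 39.     Notation rT := 40.    Notation rt := 41.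

Notation store := (nat -> nat).

(* Two names for [upd], so that register updates can be simplified without
   touching the symbolic memory addresses. *)
Definition updr : store -> nat -> nat -> store := upd.
Definition updm : store -> nat -> nat -> store := upd.

Lemma updrE f a x b : updr f a x b = if b == a then x else f b.
Proof. by []. Qed.

Lemma updmE f a x b : updm f a x b = if b == a then x else f b.
Proof. by []. Qed.

Definition basic (i : instr) : bool :=
  match i with IJz _ _ | IJmp _ | IHalt => false | _ => true end.

Definition exins (i : instr) (s : store * store) : store * store :=
  let: (R, M) := s in
  match i with
  | IConst r k => (updr R r k, M)
  | IAdd r a b => (updr R r (R a + R b), M)
  | ISub r a b => (updr R r (R a - R b), M)
  | ILoad r a => (updr R r (M (R a)), M)
  | IStore a r => (R, updm M (R a) (R r))
  | _ => (R, M)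
  end.

Fixpoint exblk (l : seq instr) (s : store * store) : store * store :=
  if l is i :: l' then exblk l' (exins i s) else s.

Inductive cmd : Type :=
| Blk (l : seq instr)
| Seq (c1 c2 : cmd)
| If (r : nat) (c1 c2 : cmd)
| While (r : nat) (c : cmd).

Fixpoint clen (c : cmd) : nat :=
  match c with
  | Blk l => size l
  | Seq c1 c2 => clen c1 + clen c2
  | If _ c1 c2 => clen c1 + clen c2 + 2
  | While _ c => clen c + 2
  end.

Fixpoint wf (c : cmd) : bool :=
  match c with
  | Blk l => all basic l
  | Seq c1 c2 | If _ c1 c2 => wf c1 && wf c2
  | While _ c => wf c
  end.

(** [o] is the address at which the code is placed; it is needed because the jumps of the machine
    are absolute. *)
Fixpoint compile (o : nat) (c : cmd) : seq instr :=
  match c with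
  | Blk l => l
  | Seq c1 c2 => compile o c1 ++ compile (o + clen c1) c2
  | If r c1 c2 =>
      IJz r (o + clen c1 + 2) :: compile o.+1 c1 ++
      IJmp (o + clen c1 + clen c2 + 2) :: compile (o + clen c1 + 2) c2
  | While r c =>
      IJz r (o + clen c + 2) :: rcons (compile o.+1 c) (IJmp o)
  end.

(** The times are those of the compiled code. The first branch of [If] pays for the test and for the
    jump over the second branch, the second branch only for the test; an iteration of a loop pays
    for the test and the jump back. *)
Inductive exec : cmd -> store -> store -> nat -> store -> store -> Prop :=
| ExBlk l R M : exec (Blk l) R M (size l) (exblk l (R, M)).1 (exblk l (R, M)).2
| ExSeq c1 c2 R M t1 R1 M1 t2 R2 M2 :
    exec c1 R M t1 R1 M1 -> exec c2 R1 M1 t2 R2 M2 ->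
    exec (Seq c1 c2) R M (t1 + t2) R2 M2
| ExIfT r c1 c2 R M t R' M' :
    R r <> 0 -> exec c1 R M t R' M' -> exec (If r c1 c2) R M t.+2 R' M'
| ExIfF r c1 c2 R M t R' M' :
    R r = 0 -> exec c2 R M t R' M' -> exec (If r c1 c2) R M t.+1 R' M'
| ExWhile0 r c R M : R r = 0 -> exec (While r c) R M 1 R M
| ExWhileS r c R M t1 R1 M1 t2 R2 M2 :
    R r <> 0 -> exec c R M t1 R1 M1 -> exec (While r c) R1 M1 t2 R2 M2 ->
    exec (While r c) R M (t1 + t2).+2 R2 M2.

Lemma size_compile o c : size (compile o c) = clen c.
Proof.
elim: c o => [l|c1 IH1 c2 IH2|r c1 IH1 c2 IH2|r c IH] o //=.
- by rewrite size_cat IH1 IH2.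
- by rewrite size_cat /= IH1 IH2; lia.
- by rewrite size_rcons IH addn2.
Qed.

Lemma runD P t1 t2 s : run P (t1 + t2) s = run P t2 (run P t1 s).
Proof.
elim: t1 s => [|t1 IH] s //=.
case E: (step P s) => [s'|]; first exact: IH.
by clear IH; case: t2 => [|t2] //=; rewrite E.
Qed.

Lemma runS P t s s' : step P s = Some s' -> run P t.+1 s = run P t s'.
Proof. by move=> /= ->. Qed.

Local Arguments run : simpl never.

Definition code_at (P : program) (o : nat) (l : seq instr) : Prop :=
  forall i, i < size l -> nth IHalt P (o + i) = nth IHalt l i.

Lemma code_at_cat P o l1 l2 :
  code_at P o (l1 ++ l2) -> code_at P o l1 /\ code_at P (o + size l1) l2.
Proof.
move=> H; split=> i Hi.
  by rewrite H ?size_cat; [rewrite nth_cat Hi | lia].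
by rewrite -addnA H ?size_cat ?nth_cat; [case: ltnP; [lia | rewrite addKn] | lia].
Qed.

Lemma code_at_cons P o i l :
  code_at P o (i :: l) -> nth IHalt P o = i /\ code_at P o.+1 l.
Proof.
move=> H; split; first by have := H 0 isT; rewrite addn0.
by move=> k Hk; have := H k.+1 Hk; rewrite addnS.
Qed.

Lemma run_blk P o l R M : all basic l -> code_at P o l ->
  run P (size l) (St o R M)
  = St (o + size l) (exblk l (R, M)).1 (exblk l (R, M)).2.
Proof.
elim: l o R M => [|i l IH] o R M /=; first by rewrite addn0.
case/andP=> bi bl /code_at_cons [Ei Hl].
have -> : run P (size l).+1 (St o R M)
  = run P (size l) (St o.+1 (exins i (R, M)).1 (exins i (R, M)).2).
  by apply: runS; rewrite /step Ei; case: i bi {Ei}.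
by rewrite IH // addSnnS -surjective_pairing.
Qed.

Lemma compile_correct P c R M t R' M' o :
  exec c R M t R' M' -> wf c -> code_at P o (compile o c) ->
  run P t (St o R M) = St (o + clen c) R' M'.
Proof.
move=> E; elim: E o => {c R M t R' M'}.
- by move=> l R M o /= wl cl; apply: run_blk.
- move=> c1 c2 R M t1 R1 M1 t2 R2 M2 _ IH1 _ IH2 o /= /andP[w1 w2].
  case/code_at_cat; rewrite size_compile => H1 H2.
  by rewrite runD IH1 // IH2 // addnA.
- move=> r c1 c2 R M t R' M' Hr _ IH o /= /andP[w1 w2].
  case/code_at_cons=> E0 /code_at_cat[H1]; rewrite size_compile.
  case/code_at_cons=> E1 H2.
  rewrite (@runS _ _ _ (St o.+1 R M)) /step ?E0; last by case: eqP.
  rewrite -(addn1 t) runD IH // (runS _ (s' := St (o + clen c1 + clen c2 + 2) R' M')).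
    by congr St; lia.
  by rewrite /step E1.
- move=> r c1 c2 R M t R' M' Hr _ IH o /= /andP[w1 w2].
  case/code_at_cons=> E0 /code_at_cat[H1]; rewrite size_compile.
  case/code_at_cons=> E1 H2.
  rewrite (@runS _ _ _ (St (o + clen c1 + 2) R M)) /step ?E0 ?Hr ?eqxx //.
  rewrite IH //; first by congr St; lia.
  by have E : (o.+1 + clen c1).+1 = o + clen c1 + 2; [lia | rewrite E in H2].
- move=> r c R M Hr o /= w1 /code_at_cons[E0 _].
  rewrite (@runS _ _ _ (St (o + clen c + 2) R M)) /step ?E0 ?Hr ?eqxx //.
  by rewrite /run addnA.
- move=> r c R M t1 R1 M1 t2 R2 M2 Hr _ IH1 _ IH2 o /= w1 H.
  case/code_at_cons: (H)=> E0; rewrite -cats1.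
  case/code_at_cat=> H1; rewrite size_compile => /code_at_cons [E1 _].
  rewrite (@runS _ _ _ (St o.+1 R M)) /step ?E0; last by case: eqP.
  have -> : (t1 + t2).+1 = t1 + t2.+1 by lia.
  rewrite runD IH1 // (runS _ (s' := St o R1 M1)) ?IH2 //.
  by rewrite /step E1.
Qed.

Definition dst (i : instr) : seq nat :=
  match i with
  | IConst r _ | IAdd r _ _ | ISub r _ _ | ILoad r _ => [:: r]
  | _ => [::]
  end.

Fixpoint mods (c : cmd) : seq nat :=
  match c with
  | Blk l => flatten (map dst l)
  | Seq c1 c2 | If _ c1 c2 => mods c1 ++ mods c2
  | While _ c => mods c
  end.

(** Since the registers a command may write can be read off its syntax ([mods]), this frame
    condition holds for every execution and need not be repeated in the specifications below. *)
Definition agree (W : seq nat) (R R' : store) : Prop :=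
  forall r, r \notin W -> R' r = R r.

Lemma agree_blk l R M : agree (flatten (map dst l)) R (exblk l (R, M)).1.
Proof.
elim: l R M => [|i l IH] R M r //=.
rewrite mem_cat negb_or => /andP[Hi Hl].
by case: i Hi => [d k|d a b|d a b|d a|a b|a b|a|] /= Hi; rewrite (IH _ _ r) //;
  move: Hi; rewrite inE updrE => /negbTE ->.
Qed.

Lemma exec_agree c R M t R' M' : exec c R M t R' M' -> agree (mods c) R R'.
Proof.
elim=> {c R M t R' M'} //=.
- by move=> l R M; apply: agree_blk.
- move=> c1 c2 R M t1 R1 M1 t2 R2 M2 _ H1 _ H2 r.
  by rewrite mem_cat negb_or => /andP[? ?]; rewrite H2 // H1.
- move=> r c1 c2 R M t R' M' _ _ H1 x.
  by rewrite mem_cat negb_or => /andP[? ?]; rewrite H1.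
- move=> r c1 c2 R M t R' M' _ _ H1 x.
  by rewrite mem_cat negb_or => /andP[? ?]; rewrite H1.
- by move=> r c R M t1 R1 M1 t2 R2 M2 _ _ H1 _ H2 x Hx; rewrite H2 // H1.
Qed.

(** * Total correctness with running time *)

Definition wp (c : cmd) (R M : store) (Q : nat -> store -> store -> Prop) : Prop :=
  exists t R' M', exec c R M t R' M' /\ Q t R' M'.

Lemma wp_blk l R M Q :
  Q (size l) (exblk l (R, M)).1 (exblk l (R, M)).2 -> wp (Blk l) R M Q.
Proof. by move=> H; do 3 eexists; split; [apply: ExBlk |]. Qed.

Lemma wp_seq c1 c2 R M Q :
  wp c1 R M (fun t1 R1 M1 => wp c2 R1 M1 (fun t2 => Q (t1 + t2))) ->
  wp (Seq c1 c2) R M Q.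
Proof.
case=> t1 [R1 [M1 [E1 [t2 [R2 [M2 [E2 H]]]]]]].
by exists (t1 + t2), R2, M2; split=> //; apply: ExSeq E1 E2.
Qed.

Lemma wp_if r c1 c2 R M (Q : nat -> store -> store -> Prop) :
  (R r <> 0 -> wp c1 R M (fun t => Q t.+2)) ->
  (R r = 0 -> wp c2 R M (fun t => Q t.+1)) -> wp (If r c1 c2) R M Q.
Proof.
move=> H1 H2; case: (R r =P 0) => Hr.
  have [t [R' [M' [E H]]]] := H2 Hr; exists t.+1, R', M'; split=> //.
  exact: ExIfF.
have [t [R' [M' [E H]]]] := H1 Hr; exists t.+2, R', M'; split=> //.
exact: ExIfT.
Qed.

(** The rule of consequence, which also hands out the frame condition on registers. *)
Lemma wp_mono c R M (Q Q' : nat -> store -> store -> Prop) :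
  wp c R M Q ->
  (forall t R' M', agree (mods c) R R' -> Q t R' M' -> Q' t R' M') ->
  wp c R M Q'.
Proof.
case=> t [R' [M' [E H]]] HQ; exists t, R', M'; split=> //.
by apply: HQ => //; apply: exec_agree E.
Qed.

(* Every iteration takes time, so a bound on the elapsed time in the
   invariant also yields termination. *)
Lemma wp_while r c R M T (I Q : nat -> store -> store -> Prop) :
  (forall t R' M', I t R' M' -> t <= T) ->
  I 0 R M ->
  (forall t R' M', agree (mods c) R R' -> I t R' M' -> R' r <> 0 ->
     wp c R' M' (fun t' => I (t + t' + 2))) ->
  (forall t R' M', agree (mods c) R R' -> I t R' M' -> R' r = 0 ->
     Q t.+1 R' M') ->
  wp (While r c) R M Q.
Proof.
move=> HT I0 Hb HQ.
have Ha : agree (mods c) R R by [].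
suff H k : forall t R' M', T - t < k -> agree (mods c) R R' -> I t R' M' ->
    wp (While r c) R' M' (fun t' => Q (t + t')).
  by apply: H I0; [exact: ltnSn | exact: Ha].
elim: k => [|k IH] t R' M' // Hk Ha' HI.
case: (R' r =P 0) => Hr.
  exists 1, R', M'; split; first exact: ExWhile0.
  by rewrite addn1; apply: HQ.
have [t1 [R1 [M1 [E1 I1]]]] := Hb _ _ _ Ha' HI Hr.
have [||t2 [R2 [M2 [E2 H2]]]] := IH _ _ _ _ _ I1.
- by have := HT _ _ _ I1; lia.
- by move=> x Hx; rewrite (exec_agree E1) // Ha'.
exists (t1 + t2).+2, R2, M2; split; first exact: ExWhileS E1 E2.
by have -> : t + (t1 + t2).+2 = t + t1 + 2 + t2 by lia.
Qed.

(** All loops, nested ones included, share [rt] for the number of remaining iterations; this is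
    sound because [rt] is recomputed after each run of the body. The start value of [i] is left to
    the caller. *)
Definition For (i lim : nat) (c : cmd) : cmd :=
  Seq (Blk [:: ISub rt lim i])
      (While rt (Seq c (Blk [:: IAdd i i rone; ISub rt lim i]))).

(** An iteration adds 4 steps to its body: the increment, the update of [rt], the test and the jump
    back. The 2 steps in the postcondition are the initial subtraction and the final test. *)
Lemma wp_for i lim c R M s N T (I : nat -> nat -> store -> store -> Prop) Q :
  R i = s -> R lim = N -> R rone = 1 -> s <= N -> i != rt -> lim != rt -> i != lim ->
  lim \notin mods c -> i \notin mods c -> rone \notin mods c -> i != rone ->
  (forall k t R' M', s <= k <= N -> I k t R' M' -> t <= T) ->
  I s 0 (updr R rt (N - s)) M ->
  (forall k t R' M', s <= k < N -> agree (rt :: i :: mods c) R R' -> R' i = k ->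
     I k t R' M' ->
     wp c R' M' (fun t' R'' M'' =>
       I k.+1 (t + t' + 4) (updr (updr R'' i k.+1) rt (N - k.+1)) M'')) ->
  (forall t R' M', agree (rt :: i :: mods c) R R' -> R' i = N ->
     I N t R' M' -> Q t.+2 R' M') ->
  wp (For i lim c) R M Q.
Proof.
move=> Hi Hlim H1 HsN it lt il lc ic r1c i1 HT I0 Hb HQ.
apply: wp_seq; apply: wp_blk => /=; rewrite Hi Hlim.
have Hn r : r \notin rt :: i :: mods c ->
    [/\ r != rt, r != i & r \notin mods c].
  by rewrite !inE !negb_or => /and3P.
apply: (@wp_while _ _ _ _ T (fun t R' M' => exists k,
   [/\ s <= k <= N, agree (rt :: i :: mods c) R R', R' i = k,
       R' rt = N - k & I k t R' M'])).
- by move=> t R' M' [k [Hk _ _ _ /(HT _ _ _ _ Hk)]].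
- exists s; split=> //; first by rewrite leqnn.
  + by move=> r /Hn [Hr _ _]; rewrite updrE (negbTE Hr).
  + by rewrite updrE (negbTE it).
- move=> t R' M' _ [k [Hk Ha Hki Hkt HI]] Hne.
  have Hk' : s <= k < N by move: Hk Hne; rewrite Hkt; lia.
  apply: wp_seq; apply: (wp_mono (Hb _ _ _ _ Hk' Ha Hki HI)).
  move=> t' R'' M'' Hac HI'; apply: wp_blk => /=.
  have Rlim : R'' lim = N.
    by rewrite Hac // Ha // !inE !negb_or lt eq_sym il.
  have Ri : R'' i = k by rewrite Hac.
  have R1 : R'' rone = 1 by rewrite Hac // Ha // !inE !negb_or (eq_sym _ i) i1.
  exists k.+1; rewrite !updrE (negbTE it) eqxx (eq_sym lim) (negbTE il).
  rewrite Ri R1 Rlim addn1; split=> //; first lia.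
    move=> r /[dup] Hr /Hn [rrt rri rcc]; rewrite !updrE (negbTE rrt) (negbTE rri).
    by rewrite Hac // Ha.
  by have -> : t + (t' + 2) + 2 = t + t' + 4 by lia.
- move=> t R' M' _ [k [Hk Ha Hki Hkt HI]] He.
  have E : k = N by lia.
  by rewrite E in Hki HI; apply: HQ.
Qed.

(** * Growth of values *)

(* All registers except the address register [rT] grow only by adding [rn] or
   [rone], which stay fixed; [rT] is never fed back.  So values grow linearly
   in time. *)
Definition grow_ok (q : nat) (i : instr) : bool :=
  let K r := (r == rn) || (r == rone) in
  match i with
  | IConst r k => ~~ K r && (k <= 10)
  | IAdd r a b => [&& ~~ K r, a != rT & ((r == rT) && (b != rT)) || K b]
  | ISub r a b => ~~ K r && ((r == rT) || (a != rT))
  | ILoad r _ => ~~ K r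
  | IStore _ r => r != rT
  | IJz _ l | IJmp l => q <= l
  | IHalt => true
  end.

(** Addresses from [q] on never write [rn] and [rone], so [g] bounds every increment. [rT] may hold
    the sum of two values, hence its weaker bound. *)
Definition grown (q g V : nat) (s : state) : Prop :=
  [/\ q <= pc s, reg s rn <= g /\ reg s rone <= g,
      forall r, r != rT -> reg s r <= V, reg s rT <= 2 * V
    & forall i, Defs.mem s i <= V].

Lemma grown_step P q g V s s' :
  (forall i, q <= i -> grow_ok q (nth IHalt P i)) -> 10 <= V ->
  grown q g V s -> step P s = Some s' -> grown q g (V + g) s'.
Proof.
case: s => p R M HP V10 [/= Hq [Hn H1] HR HT HM].
have := HP p Hq.
have HV x : x <= V -> x <= V + g by lia.
have HV2 x : x <= 2 * V -> x <= 2 * (V + g) by lia.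
case: (nth IHalt P p) => [r k|r a b|r a b|r a|a r|r l|l|] //=.
- case/andP; rewrite negb_or => /andP[rn_ r1_] k10 [<-]; split=> //=.
  + lia.
  + by rewrite /upd (eq_sym rn) (negbTE rn_) (eq_sym rone) (negbTE r1_).
  + by move=> x /HR Hx; rewrite /upd; case: eqP; lia.
  + by rewrite /upd; case: eqP; lia.
  + by move=> i; apply: HV.
- case/and3P; rewrite negb_or => /andP[rn_ r1_] aT Hb [<-]; split=> //=.
  + lia.
  + by rewrite /upd (eq_sym rn) (negbTE rn_) (eq_sym rone) (negbTE r1_).
  + move=> x Hx; rewrite /upd; have := HR _ Hx; case: eqP => [E|]; last lia.
    subst x; move: Hb; rewrite (negbTE Hx) /= => /orP[/eqP|/eqP] ->;
    by have := HR _ aT; lia.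
  + rewrite /upd; case: eqP => [_|]; last lia.
    have := HR _ aT; case/orP: Hb => [/andP[_ /HR]|/orP[/eqP ->|/eqP ->]]; lia.
  + by move=> i; apply: HV.
- case/andP; rewrite negb_or => /andP[rn_ r1_] Hb [<-]; split=> //=.
  + lia.
  + by rewrite /upd (eq_sym rn) (negbTE rn_) (eq_sym rone) (negbTE r1_).
  + move=> x Hx; rewrite /upd; have := HR _ Hx; case: eqP => [E|]; last lia.
    by subst x; move: Hb; rewrite (negbTE Hx) /= => /HR; lia.
  + rewrite /upd; case: eqP => [_|]; last lia.
    by case: (a =P rT) => [->|/eqP /HR]; lia.
  + by move=> i; apply: HV.
- rewrite negb_or => /andP[rn_ r1_] [<-]; split=> //=.
  + lia.
  + by rewrite /upd (eq_sym rn) (negbTE rn_) (eq_sym rone) (negbTE r1_).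
  + by move=> x /HR Hx; have := HM (R a); rewrite /upd; case: eqP; lia.
  + by have := HM (R a); rewrite /upd; case: eqP; lia.
  + by move=> i; apply: HV.
- move=> Hr [<-]; split=> //=; first lia.
  + by move=> x /HR /HV.
  + exact: HV2.
  + by move=> i; have := HR _ Hr; have := HM i; rewrite /upd; case: eqP; lia.
- move=> Hl [<-]; split=> //=; first by case: ifP; lia.
  + by move=> x /HR /HV.
  + exact: HV2.
  + by move=> i; apply: HV.
- move=> Hl [<-]; split=> //=.
  + by move=> x /HR /HV.
  + exact: HV2.
  + by move=> i; apply: HV.
Qed.

Lemma grown_run P q g V s t :
  (forall i, q <= i -> grow_ok q (nth IHalt P i)) -> 10 <= V ->
  grown q g V s -> grown q g (V + t * g) (run P t s).
Proof.
move=> HP; elim: t V s => [|t IH] V s V10 H; first by rewrite addn0.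
rewrite /run -/run; case E: (step P s) => [s'|].
  rewrite mulSn addnA; apply: IH; first lia.
  exact: grown_step E.
case: H => ? ? HR ? HM; split=> //; last by move=> i; apply: leq_trans (HM i) _; lia.
  by move=> r /HR; lia.
by lia.
Qed.

Definition const_ok (i : instr) : bool := if i is IConst _ k then k <= 10 else true.

(** The crude bound: an instruction at most doubles the largest value. It serves for the
    initialisation, which takes constantly many steps. *)
Lemma bounded_run P V t s : all const_ok P -> 10 <= V ->
  values_bounded s V -> values_bounded (run P t s) (V * 2 ^ t).
Proof.
move=> HP; elim: t V s => [|t IH] V s V10 H; first by rewrite muln1.
have V2 : V <= V * 2 ^ t.+1 by rewrite leq_pmulr // expn_gt0.
rewrite /run -/run; case E: (step P s) => [s'|]; last first.
  by case: H => HR HM; split=> i; [have := HR i | have := HM i]; lia.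
rewrite expnS mulnA; apply: IH; first lia.
case: s H E => p R M [/= HR HM] E.
have HC : const_ok (nth IHalt P p).
  case: (ltnP p (size P)) => Hp; last by rewrite nth_default.
  exact: (all_nthP IHalt HP).
move: E HC; by case: (nth IHalt P p) => [r k|r a b|r a b|r a|a r|r l|l|] //= [<-] HC;
  split=> i /=; rewrite /upd; try (case: eqP => _);
  try (move: (HR a)); try (move: (HR b)); try (move: (HM (R a)));
  try (move: (HR r)); move: (HR i) (HM i); lia.
Qed.

(** * Breadth-first search *)

Section Bfs.

Variables (n : nat) (N : nat -> seq nat).
Hypothesis N_sym : forall u w, (w \in N u) = (u \in N w).
Hypothesis N_lt : forall u w, w \in N u -> w < n.

Notation deg u := (size (N u)).

(** The ball of radius [i] around [s] in the subgraph induced by the vertices of degree below [th];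
    it is empty if [s] itself has larger degree. *)
Fixpoint ball (th s i w : nat) : bool :=
  if i is i'.+1 then
    ball th s i' w || ((deg w < th) && has (ball th s i') (N w))
  else (w == s) && (deg w < th).

Lemma ball_lt th s i w : s < n -> ball th s i w -> w < n.
Proof.
move=> sn; elim: i w => [|i IH] w /=; first by case/andP=> /eqP ->.
case/orP=> [/IH //|/andP[_ /hasP[u uw _]]].
by apply: (@N_lt u); rewrite N_sym.
Qed.

Lemma ball_deg th s i w : ball th s i w -> deg w < th.
Proof. by elim: i => [|i IH] /=; [case/andP|case/orP=> [/IH|/andP[]]]. Qed.

Lemma ball_mono th s i j w : i <= j -> ball th s i w -> ball th s j w.
Proof.
move/subnK <-; elim: (j - i) => // k IH H.
by rewrite addSn /= IH.
Qed.

(* A search state is the queue together with the marks; a mark is 0 if the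
   vertex has not been reached and its distance plus 1 otherwise. *)
Definition push (th lev : nat) (st : seq nat * store) (w : nat) :=
  if (deg w < th) && (st.2 w == 0) then (rcons st.1 w, updm st.2 w lev) else st.

Definition scan th lev st u := foldl (push th lev) st (N u).

(* The first component is the number of queue entries already expanded. *)
Fixpoint bfs (th s j : nat) : nat * (seq nat * store) :=
  if j is j'.+1 then
    let: (hd, st) := bfs th s j' in
    (size st.1, foldl (scan th j'.+2) st (drop hd st.1))
  else (0, push th 1 ([::], fun=> 0) s).

Definition marked (st : seq nat * store) : Prop :=
  forall w, (st.2 w != 0) = (w \in st.1).

(** Stated for an arbitrary list [ws], so that it covers both the start vertex and a whole level,
    whose scans form a single fold by [foldl_scan]. *)
Lemma push_foldl th lev st ws : 0 < lev -> uniq st.1 -> marked st ->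
  let st' := foldl (push th lev) st ws in
  [/\ uniq st'.1, marked st',
      forall w, (w \in st'.1) = (w \in st.1) || ((w \in ws) && (deg w < th)),
      forall w, st'.2 w = if (w \in st.1) || (w \notin st'.1) then st.2 w else lev
    & prefix st.1 st'.1].
Proof.
move=> lev0; elim: ws st => [|x ws IH] st Hu Hm /=.
  split=> // [w|w|]; rewrite ?prefix_refl ?in_nil ?orbF //.
  by case: (w \in st.1).
have Hu' : uniq (push th lev st x).1.
  rewrite /push; case: ifP => // /andP[_ /eqP H].
  by rewrite rcons_uniq Hu -Hm H.
have Hmem w : (w \in (push th lev st x).1)
    = (w \in st.1) || ((w == x) && (deg w < th)).
  rewrite /push; case: ifP => [/andP[dx /eqP H]|].
    by rewrite mem_rcons inE orbC; case: eqP => [->|]; rewrite ?dx.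
  case: (w =P x) => [->|]; last by rewrite orbF.
  by rewrite -Hm; case: (deg x < th) => //=; [case: eqP | rewrite orbF].
have Hval w : (push th lev st x).2 w
    = if (w \in st.1) || (w \notin (push th lev st x).1) then st.2 w else lev.
  rewrite Hmem /push; case: ifP => [/andP[dx /eqP H]|Hx] /=.
    rewrite updmE; case: eqP => [->|] /=; last by case: (w \in st.1).
    by rewrite dx orbT -Hm H eqxx.
  case: (w =P x) => [->|] /=; last by case: (w \in st.1).
  move: Hx; rewrite -Hm; case: (deg x < th) => /=; last by case: (_ == 0).
  by move=> ->.
have Hm' : marked (push th lev st x).
  move=> w; rewrite Hval Hmem -Hm; case: (st.2 w =P 0) => [E|E] /=.
    by rewrite E; case: (_ && _); rewrite //= -lt0n lev0.
  by apply/eqP.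
have [H1 H2 H3 H4 H5] := IH _ Hu' Hm'; split=> // [w|w|].
- rewrite H3 Hmem inE.
  by case: (w == x); case: (w \in st.1); case: (deg w < th);
    rewrite ?andbF ?andbT ?orbT ?orbF.
- rewrite H4 Hval H3 Hmem.
  by case: (w == x); case: (w \in st.1); case: (deg w < th); case: (w \in ws).
- apply: prefix_trans H5; rewrite /push; case: ifP => _ /=; last exact: prefix_refl.
  by rewrite prefix_rcons.
Qed.

Lemma foldl_scan th lev st us :
  foldl (scan th lev) st us = foldl (push th lev) st (flatten (map N us)).
Proof. by elim: us st => //= u us IH st; rewrite foldl_cat IH. Qed.

(** [bfs_dist] says that a mark is the distance plus 1. [bfs_old] identifies the expanded entries
    with the previous ball; this is what makes it enough to expand the others in the next level. *)
Record bfs_spec (th s j hd : nat) (st : seq nat * store) : Prop := BfsSpec {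
  bfs_uniq : uniq st.1;
  bfs_marked : marked st;
  bfs_mem : forall w, (w \in st.1) = ball th s j w;
  bfs_dist : forall i w, i <= j -> (0 < st.2 w <= i.+1) = ball th s i w;
  bfs_hd : hd <= size st.1;
  bfs_old : forall u, (u \in take hd st.1) = (0 < j) && ball th s j.-1 u }.

Lemma bfsP th s j : bfs_spec th s j (bfs th s j).1 (bfs th s j).2.
Proof.
elim: j => [|j IH].
  have [] := @push_foldl th 1 ([::], fun=> 0) [:: s] isT isT (fun=> erefl _).
  move=> /= H1 H2 H3 H4 _; split=> //=.
  - by move=> w; rewrite H3 inE.
  - move=> i w; rewrite leqn0 => /eqP -> /=.
    rewrite H4 H3 inE /=; case: ifP => //; first by case: (_ && _).
    by case: (_ && _).
  - by move=> u; rewrite take0.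
rewrite /=; case E: (bfs th s j) IH => [hd st] /= [H1 H2 H3 H4 H5 H6].
rewrite foldl_scan.
have Hball w : ball th s j w || ((w \in flatten (map N (drop hd st.1))) && (deg w < th))
    = ball th s j.+1 w.
  rewrite /=; case B: (ball th s j w) => //=; rewrite andbC; case D: (deg w < th) => //=.
  apply/flatten_mapP/hasP => [[u /mem_drop uq wu]|[u uw ub]].
    by exists u; rewrite -?H3 // N_sym.
  exists u; last by rewrite N_sym.
  (* If the neighbour [u] had been expanded before, it would lie in the ball of radius [j - 1], and
     [w] already in that of radius [j]. *)
  have := H3 u; rewrite -{1}(cat_take_drop hd st.1) mem_cat ub.
  case/orP=> //; rewrite H6 => /andP[j0 ub1].
  case: j j0 ub1 B {E H3 H4 H6 ub} => //= j _ ub1.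
  by rewrite D /= orbC => /negbT; rewrite negb_or => /andP[/hasPn/(_ _ uw)]; rewrite ub1.
have [K1 K2 K3 K4 K5] :=
  @push_foldl th j.+2 st (flatten (map N (drop hd st.1))) isT H1 H2.
split=> //.
- by move=> w; rewrite K3 H3 Hball.
- move=> i w ij; rewrite K4 K3 H3 Hball.
  case: (leqP i j) => ij'.
    rewrite -(H4 i w ij'); case: ifP => //; case B: (ball th s j w) => //= Hn.
    have /eqP -> : st.2 w == 0 by apply/negPn; rewrite H2 H3 B.
    lia.
  have -> : i = j.+1 by lia.
  have Hj := H4 j w (leqnn _).
  case B: (ball th s j w) => /=.
    by rewrite -H4 // in B; move: B; lia.
  case B1: (_ || _) => /=; first by rewrite !ltnS leqnn.
  by have /eqP -> : st.2 w == 0; [apply/negPn; rewrite H2 H3 B | ].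
- by case/prefixP: K5 => t ->; rewrite size_cat leq_addr.
- by move=> u; case/prefixP: K5 => t ->; rewrite take_size_cat // H3.
Qed.

Lemma bfs_takeS th s j :
  take (bfs th s j.+1).1 (bfs th s j.+1).2.1 = (bfs th s j).2.1.
Proof.
have [U Hm _ _ _ _] := bfsP th s j.
rewrite /=; case: (bfs th s j) U Hm => [hd st] /= U Hm.
rewrite foldl_scan.
have [_ _ _ _ /prefixP[t ->]] := @push_foldl th j.+2 st (flatten (map N (drop hd st.1))) isT U Hm.
by rewrite take_size_cat.
Qed.

(** The cost of the search up to constants and a term linear in [j]: one unit for each expanded
    vertex and for each entry of its list. *)
Definition work th s j :=
  \sum_(u <- take (bfs th s j).1 (bfs th s j).2.1) (deg u).+1.

Lemma workS th s j :
  work th s j.+1 = \sum_(u <- (bfs th s j).2.1) (deg u).+1.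
Proof. by rewrite /work bfs_takeS. Qed.

Lemma sum_uniq_le (F : nat -> nat) (r : seq nat) :
  uniq r -> {in r, forall u, u < n} ->
  \sum_(u <- r) F u <= \sum_(0 <= u < n) F u.
Proof.
move=> Hu Hl; rewrite /index_iota subn0.
have Hp : perm_eq (iota 0 n) (r ++ filter [predC r] (iota 0 n)).
  apply: (@perm_trans _ (filter (mem r) (iota 0 n) ++ filter [predC r] (iota 0 n))).
    by rewrite perm_sym perm_filterC.
  rewrite perm_cat2r; apply: uniq_perm => //; first by rewrite filter_uniq ?iota_uniq.
  move=> x; rewrite mem_filter mem_iota /= add0n.
  by case: (boolP (x \in r)) => // /Hl ->.
by rewrite (perm_big _ Hp) big_cat /= leq_addr.
Qed.

Lemma bfs_lt th s j u : s < n -> u \in (bfs th s j).2.1 -> u < n.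
Proof. by move=> sn; rewrite (bfs_mem (bfsP th s j)) => /ball_lt; apply. Qed.

Lemma work_le th s j : s < n -> work th s j <= \sum_(0 <= u < n) (deg u).+1.
Proof.
move=> sn; apply: sum_uniq_le.
  by rewrite take_uniq // (bfs_uniq (bfsP th s j)).
by move=> u /mem_take; apply: bfs_lt.
Qed.

(** The next ball consists of at most [s] and the neighbours of the present one, so its size is at
    most 1 plus [b] times the present size. The factor [j.+1] stands in for the geometric sum and is
    also right for [b = 1]. *)
Lemma ball_size_le th s j b : s < n -> 0 < b -> th <= b.+1 ->
  size (bfs th s j).2.1 <= j.+1 * b ^ j.
Proof.
move=> sn b0 thb; elim: j => [|j IH].
  apply: (@uniq_leq_size _ _ [:: s]); first exact: bfs_uniq (bfsP th s 0).
  by move=> w; rewrite (bfs_mem (bfsP th s 0)) /= inE => /andP[].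
apply: (@leq_trans (1 + b * size (bfs th s j).2.1)).
  apply: (@leq_trans (size (s :: flatten (map N (bfs th s j).2.1)))).
    apply: uniq_leq_size; first exact: bfs_uniq (bfsP th s j.+1).
    move=> w; rewrite (bfs_mem (bfsP th s j.+1)) inE.
    have Hs i : ball th s i.+1 w -> (w == s) || has (ball th s i) (N w).
      elim: i => [|i IHi].
        by case/orP=> [/andP[-> //]|/andP[_ ->]]; rewrite orbT.
      case/orP=> [/IHi/orP[-> //|/hasP[u uw ub]]|/andP[_ ->]]; last by rewrite orbT.
      by apply/orP; right; apply/hasP; exists u; rewrite //= ub.
    case/Hs/orP=> [-> //|/hasP[u uw ub]]; apply/orP; right.
    by apply/flatten_mapP; exists u; rewrite ?(bfs_mem (bfsP th s j)) // N_sym.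
  rewrite /= add1n ltnS size_flatten /shape -map_comp.
  have : {in (bfs th s j).2.1, forall u, deg u <= b}.
    move=> u; rewrite (bfs_mem (bfsP th s j)) => /ball_deg; lia.
  elim: (bfs th s j).2.1 => [|u r IHr] Hr //=; rewrite mulnS leq_add ?Hr ?mem_head //.
  by apply: IHr => x xr; apply: Hr; rewrite inE xr orbT.
have : 0 < b ^ j.+1 by rewrite expn_gt0 b0.
rewrite [b ^ _]expnS; nia.
Qed.

(** Only the ball of radius [j - 1] is expanded, so the factor [b.+1 <= 2 * b] for reading the lists
    raises the power no further than to [b ^ j]. *)
Lemma work_ball_le th s j b : s < n -> 0 < b -> th <= b.+1 ->
  work th s j <= 2 * (j.+1 * b ^ j).
Proof.
move=> sn b0 thb; case: j => [|j]; first by rewrite /work take0 big_nil.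
have := ball_size_le j sn b0 thb.
rewrite workS expnS => H.
apply: (@leq_trans (b.+1 * size (bfs th s j).2.1)); last by nia.
have : {in (bfs th s j).2.1, forall u, deg u <= b}.
  move=> u; rewrite (bfs_mem (bfsP th s j)) => /ball_deg; lia.
elim: (bfs th s j).2.1 => [|u r IHr] Hr; first by rewrite big_nil.
rewrite big_cons /= mulnS leq_add ?ltnS ?Hr ?mem_head //.
by apply: IHr => x xr; apply: Hr; rewrite inE xr orbT.
Qed.

End Bfs.

(** * The machine program *)

Local Ltac simregs := simpl; repeat rewrite updrE /=.

(** A degree is the difference of two consecutive list addresses; truncated subtraction from [rth]
    leaves [ry] nonzero iff the degree is below the threshold. *)
Definition PUSH : cmd :=
  Seq (Blk [:: IAdd rT rw rone; ILoad rx rT; IAdd rT rw rtwo; ILoad ry rT;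
               ISub ry ry rx; ISub ry rth ry])
    (If ry
      (Seq (Blk [:: IAdd rT rp rw; ILoad rx rT])
        (If rx (Blk [::])
          (Blk [:: IStore rT rlev; IAdd rT bQ rtail; IStore rT rw;
                   IAdd rtail rtail rone])))
      (Blk [::])).

Definition SCAN : cmd := For ra rae (Seq (Blk [:: ILoad rw ra]) PUSH).

Definition LEVEL : cmd :=
  For rhead rhi
    (Seq (Blk [:: IAdd rT bQ rhead; ILoad ru rT; IAdd rT ru rone; ILoad ra rT;
                  IAdd rT ru rtwo; ILoad rae rT])
         SCAN).

(** Subtracting [rz] serves as the copy instruction. [rp] holds the address of the row for the
    marks, so the same code fills the distance rows of the hubs and the scratch row of the local
    search. [rhi] freezes the end of the queue before a level extends it. *)
Definition BFS : cmd :=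
  Seq (Blk [:: IConst rhead 0; IConst rtail 0; IConst rlev 1; ISub rw rsrc rz;
               IConst rj 0])
  (Seq PUSH
    (For rj rlim
      (Seq (Blk [:: ISub rhi rtail rz; IAdd rlev rlev rone]) LEVEL))).

Section Machine.

Variables (n : nat) (N : nat -> seq nat) (l : nat).
Notation deg u := (size (N u)).

(** * Hubs, types and coverage *)

Definition cnt_ge (l : nat) : nat := count (fun v => l <= deg v) (iota 0 n).

Lemma count_iotaS (p : pred nat) k :
  count p (iota 0 k.+1) = count p (iota 0 k) + p k.
Proof. by rewrite -addn1 iotaD count_cat /= addn0. Qed.

Definition hubs : seq nat := [seq v <- iota 0 n | l <= deg v].

(** A mark of the full search, hence the distance plus 1. *)
Definition hub_dist (x w : nat) : nat := (bfs N n.+1 (nth 0 hubs x) n).2.2 w.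

Lemma hubs_take k :
  [seq v <- iota 0 k.+1 | l <= deg v] =
  if l <= deg k then rcons [seq v <- iota 0 k | l <= deg v] k
  else [seq v <- iota 0 k | l <= deg v].
Proof.
rewrite -addn1 iotaD filter_cat /= add0n.
by case: ifP => _; rewrite ?cats1 ?cats0.
Qed.

Lemma hubs_prefix k : k <= n -> prefix [seq v <- iota 0 k | l <= deg v] hubs.
Proof.
by move=> Hk; rewrite /hubs -(subnKC Hk) iotaD filter_cat prefix_prefix.
Qed.

Definition vec (w : nat) : seq nat := [seq hub_dist x w | x <- iota 0 (size hubs)].

(** The first vertex of each type occurring below [i]. The recursion follows the loop of the
    machine, which inserts one vertex at a time. *)
Fixpoint reps (i : nat) : seq nat :=
  if i is i'.+1 then
    if vec i' \in map vec (reps i') then reps i' else rcons (reps i') i'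
  else [::].

Definition type_of (i w : nat) : nat := index (vec w) (map vec (reps i)).

Lemma reps_uniq i : uniq (map vec (reps i)).
Proof.
by elim: i => //= i IH; case: ifP => // H; rewrite map_rcons rcons_uniq H.
Qed.

Lemma reps_mem i w : w < i -> vec w \in map vec (reps i).
Proof.
elim: i => //= i IH; rewrite ltnS leq_eqVlt => /orP[/eqP ->|/IH H]; case: ifP => // _.
  by rewrite map_rcons mem_rcons mem_head.
by rewrite map_rcons mem_rcons inE H orbT.
Qed.

Lemma reps_lt i u : u \in reps i -> u < i.
Proof.
elim: i => //= i IH; case: ifP => _; last first.
  by rewrite mem_rcons inE => /orP[/eqP -> //|/IH]; lia.
by move/IH; lia.
Qed.

Lemma reps_size i : size (reps i) <= i.
Proof.
elim: i => //= i IH; case: ifP => _; rewrite ?size_rcons; lia.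
Qed.

Lemma type_of_lt i w : w < i -> type_of i w < size (reps i).
Proof. by move=> Hw; rewrite /type_of -(size_map vec) index_mem reps_mem. Qed.

Lemma type_ofS i w : w < i -> type_of i.+1 w = type_of i w.
Proof.
move=> Hw; rewrite /type_of /=; case: ifP => // _.
by rewrite map_rcons -cats1 index_cat reps_mem.
Qed.

(** A missing vector gets from [index] the length of the list, which is exactly the position at
    which the new representative is appended. *)
Lemma type_of_new i : type_of i.+1 i = type_of i i.
Proof.
rewrite /type_of /=; case: ifP => // H.
by rewrite map_rcons -cats1 index_cat H /= eqxx addn0 memNindex // H.
Qed.

Lemma type_of_rep i w : w < i -> vec (nth 0 (reps i) (type_of i w)) = vec w.
Proof.
move=> Hw; have H := type_of_lt Hw.
by rewrite -(nth_map 0 [::]) // nth_index // reps_mem.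
Qed.

Lemma reps_size_mono i j : i <= j -> size (reps i) <= size (reps j).
Proof.
move/subnK <-; elim: (j - i) => // k IH; apply: leq_trans IH _.
by rewrite addSn /=; case: ifP => // _; rewrite size_rcons.
Qed.

(* [k.+2], since both entries exceed the distance by 1. *)
Definition via (k v u : nat) : bool :=
  has (fun x => hub_dist x v + hub_dist x u <= k.+2) (iota 0 (size hubs)).

Lemma count_disjoint (T : Type) (p q r : pred T) (s : seq T) :
  (forall x, r x = p x || q x) -> (forall x, ~~ (p x && q x)) ->
  count r s = count p s + count q s.
Proof.
move=> Hr Hd; elim: s => //= x s ->; have := Hd x; rewrite Hr.
by case: (p x); case: (q x) => //= _; lia.
Qed.

Definition good (k v w : nat) : bool := via k v (nth 0 (reps n) (type_of n w)).

Definition covered (k v : nat) : bool :=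
  all (fun w => good k v w || ball N l v k w) (iota 0 n).

Definition all_covered (k i : nat) : bool := all (covered k) (iota 0 i).

Lemma all_coveredS k i : all_covered k i.+1 = all_covered k i && covered k i.
Proof. by rewrite /all_covered -addn1 iotaD all_cat /= andbT. Qed.

Hypothesis N_sym : forall u w, (w \in N u) = (u \in N w).
Hypothesis N_lt : forall u w, w \in N u -> w < n.

Variables (adr M0 : nat -> nat) (B0 : nat).
Hypothesis M0_start : forall u, u <= n -> M0 u.+1 = adr u.
Hypothesis adr_next : forall u, u < n -> adr u.+1 = adr u + deg u.
Hypothesis M0_adj : forall u i, u < n -> i < deg u -> M0 (adr u + i) = nth 0 (N u) i.
Hypothesis B0_start : n.+1 < B0.
Hypothesis B0_adj : forall u i, u < n -> i < deg u -> adr u + i < B0.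

(** * Memory layout and frame conditions *)

Definition row (j : nat) : nat := B0 + j * n.

Lemma rowS j : row j + n = row j.+1.
Proof. by rewrite /row; lia. Qed.

Definition env (R : store) : Prop :=
  [/\ R rn = n, R rone = 1, R rtwo = 2 & R rz = 0] /\
  [/\ R bQ = row 0, R bM = row 1, R bT = row 2 & R bR = row 3] /\
  [/\ R bC = row 4, R bG = row 5 & R bD = row 6].

Definition env_regs := [:: rn; rone; rtwo; rz; bQ; bM; bT; bR; bC; bG; bD].

Lemma env_agree W R R' : agree W R R' -> ~~ has (mem W) env_regs -> env R -> env R'.
Proof.
move=> H /hasPn Hs; rewrite /env.
have HR r : r \in env_regs -> R' r = R r by move/Hs => /H.
by rewrite !HR.
Qed.

(** The counterpart of [agree] for the memory: the input and all rows outside [W] are unchanged. *)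
Definition keeps (W : seq nat) (M M' : store) : Prop :=
  (forall a, a < B0 -> M' a = M a) /\
  (forall j i, j \notin W -> i < n -> M' (row j + i) = M (row j + i)).

Lemma keeps_refl W M : keeps W M M.
Proof. by []. Qed.

Lemma keeps_trans W M1 M2 M3 : keeps W M1 M2 -> keeps W M2 M3 -> keeps W M1 M3.
Proof.
case=> H1 H2 [H3 H4]; split=> [a Ha|j i Hj Hi]; first by rewrite H3 // H1.
by rewrite H4 // H2.
Qed.

(** Relative to [B0], row and offset are the quotient and the remainder of the address by [n]. *)
Lemma cell_eq j i j' i' : i < n -> i' < n ->
  (row j' + i' == row j + i) = (j' == j) && (i' == i).
Proof.
move=> Hi Hi'; apply/eqP/andP => [|[/eqP -> /eqP -> //]].
rewrite /row => E.
have E2 : j' * n + i' = j * n + i by lia.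
have Ej : j' = j.
  have := congr1 (fun x => x %/ n) E2.
  by rewrite !divnMDl ?(leq_ltn_trans _ Hi) // !divn_small // !addn0.
by split; apply/eqP=> //; move: E2; rewrite Ej; lia.
Qed.

Lemma cellE M j i x j' i' : i < n -> i' < n ->
  updm M (row j + i) x (row j' + i') =
  if (j' == j) && (i' == i) then x else M (row j' + i').
Proof. by move=> Hi Hi'; rewrite updmE cell_eq. Qed.

Lemma keeps_upd (W : seq nat) M j i x : j \in W -> i < n -> keeps W M (updm M (row j + i) x).
Proof.
move=> Hj Hi; split=> [a Ha|j' i' Hj' Hi'].
  by rewrite updmE; case: eqP => // E; move: Ha; rewrite E /row; lia.
by rewrite cellE //; case: eqP => // E; rewrite E Hj in Hj'.
Qed.

Definition input (M : store) : Prop := forall a, a < B0 -> M a = M0 a.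

Lemma input_keeps W M M' : keeps W M M' -> input M -> input M'.
Proof. by case=> H _ HM a Ha; rewrite H // HM. Qed.

Lemma input_start M u : input M -> u <= n -> M u.+1 = adr u.
Proof. by move=> HM Hu; rewrite HM ?M0_start //; lia. Qed.

Lemma input_adj M u i : input M -> u < n -> i < deg u -> M (adr u + i) = nth 0 (N u) i.
Proof. by move=> HM Hu Hi; rewrite HM ?M0_adj ?B0_adj. Qed.

Definition wf_queue (st : seq nat * store) : Prop :=
  [/\ marked st, uniq st.1 & {in st.1, forall w, w < n}].

(** This keeps the queue inside its row: an unmarked vertex is not queued, and the queue has no
    repetitions. *)
Lemma wf_queue_size st w : wf_queue st -> w < n -> st.2 w = 0 -> size st.1 < n.
Proof.
case=> Hm Hu Hl Hw E.
have : size (w :: st.1) <= size (iota 0 n).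
  apply: uniq_leq_size; first by rewrite /= Hu -Hm E.
  by move=> x; rewrite inE mem_iota add0n => /orP[/eqP -> //|/Hl].
by rewrite size_iota.
Qed.

Lemma wf_queue_foldl th lev st ws : 0 < lev -> wf_queue st -> {in ws, forall w, w < n} ->
  wf_queue (foldl (push N th lev) st ws).
Proof.
move=> lev0 [Hm Hu Hl] Hws.
have [K1 K2 K3 _ _] := @push_foldl N th lev st ws lev0 Hu Hm.
split=> // w; rewrite K3 => /orP[/Hl //|/andP[/Hws]//].
Qed.

Definition stored (j : nat) (st : seq nat * store) (M : store) : Prop :=
  (forall i, i < size st.1 -> M (row 0 + i) = nth 0 st.1 i) /\
  (forall w, w < n -> M (row j + w) = st.2 w).

(** * Correctness and cost of the search on the machine *)

Lemma push_spec th lev st j w R M :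
  env R -> input M -> wf_queue st -> stored j st M -> j != 0 -> w < n ->
  R rtail = size st.1 -> R rw = w -> R rlev = lev -> R rth = th -> R rp = row j ->
  wp PUSH R M (fun t R' M' => t <= 16 /\
    [/\ stored j (push N th lev st w) M', R' rtail = size (push N th lev st w).1
      & keeps [:: 0; j] M M']).
Proof.
move=> HE HI Hst [Hq Hmk] j0 Hw Htail Hrw Hlev Hth Hp.
have [[En E1 E2 Ez] [[EQ _ _ _] _]] := HE.
apply: wp_seq; apply: wp_blk; simregs.
rewrite Hrw E1 E2 addn1 addn2 Hth (input_start HI (ltnW Hw)) (input_start HI Hw) adr_next // addKn.
rewrite /push; apply: wp_if; simregs => Hd.
  have -> : deg w < th by lia.
  apply: wp_seq; apply: wp_blk; simregs; rewrite Hp Hrw Hmk //.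
  apply: wp_if; simregs => Hx.
    apply: wp_blk => /=; split=> //.
    by case: eqP Hx => //= _ _; rewrite !updrE.
  rewrite Hx eqxx /=; apply: wp_blk; simregs; rewrite EQ Htail E1 ?Hlev ?Hrw ?Hp addn1.
  have Hsz := wf_queue_size Hst Hw Hx.
  split=> //; split; last 2 first.
  - by rewrite ?updrE /= size_rcons.
  - apply: keeps_trans (keeps_upd _ _ _ _) (keeps_upd _ _ _ _) => //.
    by rewrite !inE eqxx orbT.
  - split=> /= [i|x Hx'].
      rewrite size_rcons ltnS leq_eqVlt nth_rcons => Hi.
      have Hin : i < n by case/orP: Hi => [/eqP ->|/ltn_trans]; last apply.
      rewrite !cellE //= (eq_sym 0) (negbTE j0) /=.
      case/orP: Hi => [/eqP ->|Hi]; first by rewrite eqxx ltnn.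
      by rewrite Hi ltn_eqF // Hq.
    rewrite !cellE // (negbTE j0) eqxx /= updmE.
    by case: eqP => //; rewrite Hmk.
have -> : deg w < th = false by lia.
by apply: wp_blk => /=; split=> //; rewrite !updrE.
Qed.

(** The 21 steps per list entry are 16 for [PUSH], one load and 4 for the loop. *)
Lemma scan_spec th lev st j u R M :
  env R -> input M -> wf_queue st -> stored j st M -> j != 0 -> u < n -> 0 < lev ->
  R rtail = size st.1 -> R ra = adr u -> R rae = adr u + deg u ->
  R rlev = lev -> R rth = th -> R rp = row j ->
  wp SCAN R M (fun t R' M' => t <= 21 * deg u + 2 /\
    [/\ stored j (scan N th lev st u) M', R' rtail = size (scan N th lev st u).1
      & keeps [:: 0; j] M M']).
Proof.
move=> HE HI Hst Hb j0 Hu lev0 Htail Ha Hae Hlev Hth Hp.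
have HE1 := HE.1; have [En E1 E2 Ez] := HE1.
pose F k := foldl (push N th lev) st (take (k - adr u) (N u)).
apply: (@wp_for ra rae _ _ _ (adr u) (adr u + deg u) (21 * deg u)
  (fun k t R' M' => t <= 21 * (k - adr u) /\
    [/\ stored j (F k) M', R' rtail = size (F k).1 & keeps [:: 0; j] M M'])) => //.
- lia.
- move=> k t R' M' Hk [Ht _]; lia.
- by split=> //; rewrite /F subnn take0.
- move=> k t R' M' Hk HA Hra [Ht [Hb' Htail' Hf]].
  have Hd : k - adr u < deg u by lia.
  have Ek : k = adr u + (k - adr u) by lia.
  have HE' := env_agree HA isT HE.
  have HI' := input_keeps Hf HI.
  have HN : {in N u, forall w, w < n} by move=> w; apply: N_lt.
  have Hst' : wf_queue (F k) by apply: wf_queue_foldl => // w /mem_take; apply: HN.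
  have EF : F k.+1 = push N th lev (F k) (nth 0 (N u) (k - adr u)).
    rewrite /F subSn; last by lia.
    by rewrite (take_nth 0) // foldl_rcons.
  apply: wp_seq; apply: wp_blk; rewrite /= Hra [in M' k]Ek (input_adj HI') //.
  apply: (wp_mono (@push_spec th lev (F k) j (nth 0 (N u) (k - adr u)) _ _ _ HI' Hst' Hb' j0 _ _ _ _ _ _));
    rewrite ?updrE //=.
  + by apply: HN; rewrite mem_nth.
  + by rewrite (HA rlev).
  + by rewrite (HA rth).
  + by rewrite (HA rp).
  move=> t' R'' M'' _ [Ht' [Hb'' Htail'' Hf'']].
  split; first by lia.
  rewrite EF; split=> //.
  exact: keeps_trans Hf Hf''.
- move=> t R' M' HA _; rewrite /F addKn take_size => -[Ht H]; split=> //; lia.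
Qed.

Lemma wf_queue_scan th lev st us : 0 < lev -> wf_queue st ->
  let st' := foldl (scan N th lev) st us in wf_queue st' /\ prefix st.1 st'.1.
Proof.
move=> lev0 Hst; have [Hm Hu _] := Hst; rewrite /= foldl_scan.
have [_ _ _ _ Hp] := @push_foldl N th lev st (flatten (map N us)) lev0 Hu Hm.
split=> //; apply: wf_queue_foldl => // w /flatten_mapP[u _]; exact: N_lt.
Qed.

Lemma level_spec th lev st j hd R M :
  env R -> input M -> wf_queue st -> stored j st M -> j != 0 -> 0 < lev ->
  hd <= size st.1 ->
  R rtail = size st.1 -> R rhead = hd -> R rhi = size st.1 ->
  R rlev = lev -> R rth = th -> R rp = row j ->
  let st' := foldl (scan N th lev) st (drop hd st.1) in
  wp LEVEL R M (fun t R' M' =>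
    t <= 30 * (\sum_(u <- drop hd st.1) (deg u).+1) + 2 /\
    [/\ stored j st' M', R' rtail = size st'.1, R' rhead = size st.1
      & keeps [:: 0; j] M M']).
Proof.
move=> HE HI Hst Hb j0 lev0 Hhd Htail Hhead Hhi Hlev Hth Hp st'.
have [[En E1 E2 Ez] [[EQ _ _ _] _]] := HE.
pose us k := take (k - hd) (drop hd st.1).
pose F k := foldl (scan N th lev) st (us k).
pose W k := 30 * (\sum_(u <- us k) (deg u).+1).
have Husall : us (size st.1) = drop hd st.1.
  by rewrite /us take_oversize // size_drop.
have Hus k : hd <= k < size st.1 -> us k.+1 = rcons (us k) (nth 0 st.1 k).
  move=> Hk; rewrite /us subSn; last by lia.
  rewrite (take_nth 0) ?size_drop; last by lia.
  by rewrite nth_drop subnKC //; lia.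
have WS k : hd <= k < size st.1 -> W k.+1 = W k + 30 * (deg (nth 0 st.1 k)).+1.
  by move=> Hk; rewrite /W Hus // -cats1 big_cat big_seq1 mulnDr.
apply: (@wp_for rhead rhi _ _ _ hd (size st.1) (W (size st.1))
  (fun k t R' M' => t <= W k /\
    [/\ stored j (F k) M', R' rtail = size (F k).1 & keeps [:: 0; j] M M'])) => //.
- move=> k t R' M' Hk [Ht _]; apply: leq_trans Ht _.
  rewrite /W leq_mul2l /= Husall.
  by rewrite -{1}(cat_take_drop (k - hd) (drop hd st.1)) big_cat leq_addr.
- by split=> //; rewrite /F /us subnn take0.
- move=> k t R' M' Hk HA Hrh [Ht [Hb' Htail' Hf]].
  have HE' := env_agree HA isT HE.
  have [[En' E1' E2' Ez'] [[EQ' _ _ _] _]] := HE'.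
  have HI' := input_keeps Hf HI.
  have [Hst' /prefixP[q Eq]] := wf_queue_scan th (us k) lev0 Hst.
  rewrite -/(F k) in Hst' Eq.
  pose u := nth 0 st.1 k.
  have Hks : k < size st.1 by case/andP: Hk.
  have Hu : u < n by case: Hst => _ _; apply; apply: mem_nth.
  have EF : F k.+1 = scan N th lev (F k) u by rewrite /F Hus // foldl_rcons.
  (* The queue may have grown since the level began, but entries are only appended, so position [k]
     still holds the old entry. *)
  have Eu : M' (row 0 + k) = u.
    rewrite (proj1 Hb') Eq ?size_cat ?nth_cat; last by lia.
    by have -> : k < size st.1 by lia.
  apply: wp_seq; apply: wp_blk; simregs; rewrite EQ' Hrh Eu E1' E2' addn1 addn2.
  apply: (wp_mono (@scan_spec th lev (F k) j u _ _ _ HI' Hst' Hb' j0 Hu lev0 _ _ _ _ _ _)); rewrite //=.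
  + by rewrite !updrE /= (input_start HI') // ltnW.
  + by rewrite !updrE /= (input_start HI') // adr_next.
  + by rewrite !updrE /= (HA rlev).
  + by rewrite !updrE /= (HA rth).
  + by rewrite !updrE /= (HA rp).
  move=> t' R'' M'' _ [Ht' [Hb'' Htail'' Hf'']].
  split; first by rewrite WS //; rewrite -/u; lia.
  rewrite EF; split=> //.
  exact: keeps_trans Hf Hf''.
- move=> t R' M' HA Hrh; rewrite /W /F Husall => -[Ht [? ? ?]]; split=> //; lia.
Qed.

Lemma BFS_spec th s j lim R M :
  env R -> input M -> j != 0 -> s < n ->
  (forall w, w < n -> M (row j + w) = 0) ->
  R rsrc = s -> R rlim = lim -> R rth = th -> R rp = row j ->
  let st := (bfs N th s lim).2 in
  wp BFS R M (fun t R' M' =>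
    t <= 30 * work N th s lim + 10 * lim + 30 /\
    [/\ stored j st M', R' rtail = size st.1 & keeps [:: 0; j] M M']).
Proof.
move=> HE HI j0 Hs H0 Hsrc Hlim Hth Hp st.
have [[En E1 E2 Ez] _] := HE.
have Hst0 : wf_queue ([::], fun=> 0) by [].
apply: wp_seq; apply: wp_blk; simregs; rewrite Hsrc Ez subn0.
apply: wp_seq.
apply: (wp_mono (@push_spec th 1 ([::], fun=> 0) j s _ _ _ HI Hst0 _ j0 Hs _ _ _ _ _)) => //=.
move=> t0 R0 M1 HA0 [Ht0 [Hb0 Htail0 Hf0]].
have HR0 := HA0.
pose W k := 30 * work N th s k + 10 * k.
have Hwf k : wf_queue (bfs N th s k).2.
  have [Hu Hm _ _ _ _] := bfsP N_sym th s k.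
  split=> // u; exact: (bfs_lt N_sym N_lt).
apply: (@wp_for rj rlim _ _ _ 0 lim (W lim)
  (fun k t R' M' => t <= W k /\
    [/\ stored j (bfs N th s k).2 M', R' rtail = size (bfs N th s k).2.1,
        R' rhead = (bfs N th s k).1, R' rlev = k.+1 & keeps [:: 0; j] M M'])) => //.
all: try by rewrite HR0 // !updrE.
- move=> k t R' M' Hk [Ht _]; apply: leq_trans Ht _.
  suff : work N th s k <= work N th s lim by rewrite /W; lia.
  have -> : lim = k + (lim - k) by lia.
  elim: (lim - k) => [|i IH]; first by rewrite addn0.
  apply: leq_trans IH _; rewrite addnS workS // /work.
  by rewrite -{2}(cat_take_drop (bfs N th s (k + i)).1 (bfs N th s (k + i)).2.1) big_cat leq_addr.
- by split=> //; split=> //; rewrite !updrE /= HR0 // !updrE.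
- move=> k t R' M' Hk HA Hrj [Ht [Hb Htail Hhead Hlev Hf]].
  have HE' : env R'.
    apply: (env_agree HA) => //; apply: (env_agree HA0) => //.
  have [[En' E1' E2' Ez'] _] := HE'.
  have HI' := input_keeps Hf HI.
  have [_ _ _ _ Hhd _] := bfsP N_sym th s k.
  apply: wp_seq; apply: wp_blk; simregs; rewrite Ez' subn0 E1' Hlev addn1.
  apply: (wp_mono (@level_spec th k.+2 (bfs N th s k).2 j (bfs N th s k).1 _ _ _ HI' (Hwf k) Hb j0 _ Hhd _ _ _ _ _ _)) => //=.
  + by rewrite !updrE /= (HA rth) // (HR0 rth).
  + by rewrite !updrE /= (HA rp) // (HR0 rp).
  move=> t' R'' M'' HA'' [Ht' [Hb'' Htail'' Hhead'' Hf'']].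
  split.
    have := workS N_sym th s k; rewrite -(cat_take_drop (bfs N th s k).1 (bfs N th s k).2.1).
    rewrite big_cat /= -/(work N th s k) /W => ->.
    by move: Ht Ht'; rewrite /W; lia.
  have HEE : bfs N th s k.+1 = (size (bfs N th s k).2.1,
     foldl (scan N th k.+2) (bfs N th s k).2 (drop (bfs N th s k).1 (bfs N th s k).2.1)).
    by rewrite /=; case: (bfs N th s k).
  move: HEE; rewrite /= => ->; split=> //=.
  + by rewrite !updrE /= (HA'' rlev) // !updrE.
  + exact: keeps_trans Hf Hf''.
- move=> t R' M' HA Hrj; rewrite /W => -[Ht [? ? _ _ ?]]; split=> //; lia.
Qed.

(* Leaves 0 in [ry] iff the degree is at least [rl]. *)
Definition DEG (v : nat) : cmd :=
  Blk [:: IAdd rT v rone; ILoad rx rT; IAdd rT v rtwo; ILoad ry rT;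
          ISub ry ry rx; ISub ry rl ry].

(** * The threshold and the distances from the hubs *)

Definition THRESHOLD : cmd :=
  Seq (Blk [:: IConst rl 1; IConst rbad 1])
    (While rbad
      (Seq (Blk [:: IConst rc 0; IConst rv 0])
      (Seq (For rv rn (Seq (DEG rv)
             (If ry (Blk [::]) (Blk [:: IAdd rc rc rone]))))
      (Seq (Blk [:: ISub rx rl rc])
           (If rx (Blk [:: IConst rbad 0]) (Blk [:: IAdd rl rl rone])))))).

Definition HUBROWS : cmd :=
  Seq (Blk [:: IConst rnh 0; ISub rp bD rz; ISub rlim rn rz; IAdd rth rn rone;
               IConst rsrc 0])
    (For rsrc rn (Seq (DEG rsrc)
      (If ry (Blk [::])
        (Seq BFS (Blk [:: IAdd rnh rnh rone; IAdd rp rp rn]))))).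

(** Each candidate is tested by recounting in time linear in [n]. The inequality for [th.-1] records
    that the preceding candidate passed; it later gives [th.-1 <= h], so the recounting costs O(h n)
    in total. *)
Lemma threshold_spec R M : env R -> input M ->
  wp THRESHOLD R M (fun t R' M' => exists th,
    [/\ M' = M, R' rl = th, 0 < th & t <= th * (20 * n + 20)] /\
    (th.-1 <= cnt_ge th.-1 /\ cnt_ge th < th)).
Proof.
move=> HE HI; have [[En E1 E2 Ez] _] := HE.
apply: wp_seq; apply: wp_blk; simregs.
apply: (@wp_while _ _ _ _ (n.+1 * (20 * n + 20)) (fun t R' M' => exists th,
  [/\ M' = M, R' rl = th, 0 < th & th.-1 <= cnt_ge th.-1] /\
  if R' rbad == 0 then t + 5 <= th * (20 * n + 20) /\ cnt_ge th < th
  else t <= th.-1 * (20 * n + 20))).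
- move=> t R' M' [th [[_ _ l0 Hl] H]].
  (* A candidate that passed is at most a number of vertices, which bounds the number of rounds. *)
  have : th.-1 <= n by rewrite (leq_trans Hl) // -[X in _ <= X](size_iota 0 n) count_size.
  by move: H; case: ifP => _; nia.
- by exists 1; split=> //; rewrite !updrE.
- move=> t R' M' HA [th [[-> Hrl l0 Hl] H]] Hbad.
  have HE' : env R' by apply: (env_agree HA) => //; rewrite /env !updrE.
  have [[En' E1' E2' Ez'] _] := HE'.
  move: H; case: eqP => // _ Ht.
  apply: wp_seq; apply: wp_blk; simregs.
  apply: wp_seq.
  pose F k := count (fun v => th <= deg v) (iota 0 k).
  have FS k : F k.+1 = F k + (th <= deg k) := count_iotaS _ _.
  apply: (@wp_for rv rn _ _ _ 0 n (16 * n) (fun k t R'' M'' =>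
    [/\ M'' = M, t <= 16 * k & R'' rc = F k])) => //=.
  + by move=> k t' R'' M'' Hk [_ Ht' _]; lia.
  + move=> k t' R'' M'' Hk HA' Hv [-> Ht' Hc].
    have Hkn : k < n by lia.
    have [[_ E1'' E2'' _] _] : env R'' by apply: (env_agree HA').
    apply: wp_seq; apply: wp_blk; simregs.
    rewrite Hv E1'' E2'' addn1 addn2 (HA' rl) //= !updrE /= Hrl.
    rewrite (input_start HI (ltnW Hkn)) (input_start HI Hkn) adr_next // addKn.
    apply: wp_if; rewrite !updrE /= => Hd; apply: wp_blk; simregs; rewrite ?E1'' FS;
      split=> //; rewrite ?Hc; lia.
  move=> t' R'' M'' HA' _ [-> Ht' Hc].
  have Hrl' : R'' rl = th by rewrite HA'.
  have [[_ E1'' E2'' _] _] : env R'' by apply: (env_agree HA').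
  apply: wp_seq; apply: wp_blk; simregs; rewrite Hrl' Hc.
  apply: wp_if; rewrite !updrE /= => Hd; apply: wp_blk; simregs.
    exists th; simregs; rewrite -/(F n) /cnt_ge -/(F n); split=> //; split; last by lia.
    have : th * (20 * n + 20) = th.-1 * (20 * n + 20) + (20 * n + 20) by rewrite -{1}(prednK l0) mulSn addnC.
    lia.
  exists th.+1; simregs; rewrite E1'' addn1; split; first by rewrite /cnt_ge -/(F n); split=> //; lia.
  have -> : R'' rbad = R' rbad by rewrite HA'.
  case: eqP => // _.
  have : th * (20 * n + 20) = th.-1 * (20 * n + 20) + (20 * n + 20) by rewrite -{1}(prednK l0) mulSn addnC.
  lia.
- move=> t R' M' HA [th [[-> Hrl l0 Hl] H]] Hbad.
  move: H; rewrite Hbad eqxx => -[Ht Hc].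
  exists th; split; split=> //; lia.
Qed.

(** The rows not yet filled are recorded as zero because a search expects a cleared row of marks. *)
Definition hub_rows (nh : nat) (M : store) : Prop :=
  forall x w, w < n -> M (row (6 + x) + w) = if x < nh then hub_dist x w else 0.

Lemma hubrows_spec R M : env R -> input M -> R rl = l -> hub_rows 0 M ->
  wp HUBROWS R M (fun t R' M' =>
    [/\ t <= 20 * n + 20 + size hubs * (30 * (\sum_(0 <= u < n) (deg u).+1) + 10 * n + 50),
        R' rnh = size hubs, hub_rows (size hubs) M' & keeps (0 :: iota 6 n) M M']).
Proof.
move=> HE HI Hl HD.
have [[En E1 E2 Ez] [_ [_ _ EbD]]] := HE.
apply: wp_seq; apply: wp_blk; simregs; rewrite Ez EbD En !subn0 E1 addn1.
pose F k := size [seq v <- iota 0 k | l <= deg v].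
pose C := 30 * (\sum_(0 <= u < n) (deg u).+1) + 10 * n + 50.
have HF k : k <= n -> F k <= size hubs.
  by move=> /hubs_prefix /prefixP[q Eq]; rewrite Eq size_cat leq_addr.
have HFk k : F k <= k.
  by rewrite /F -[X in _ <= X](size_iota 0 k) size_filter count_size.
apply: (@wp_for rsrc rn _ _ _ 0 n (16 * n + size hubs * C) (fun k t R' M' =>
  [/\ t <= 16 * k + F k * C, R' rnh = F k, R' rp = row (6 + F k),
      hub_rows (F k) M' & keeps (0 :: iota 6 n) M M'])) => //=.
- move=> k t R' M' Hk [Ht _ _ _ _]; have := HF k; nia.
- move=> k t R' M' Hk HA Hsrc [Ht Hnh Hp HD' Hf].
  have Hkn : k < n by lia.
  have HE' : env R' by apply: (env_agree HA).
  have [[En' E1' E2' Ez'] _] := HE'.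
  have HI' := input_keeps Hf HI.
  have Hlim : R' rlim = n by rewrite HA.
  have Hth : R' rth = n.+1 by rewrite HA.
  apply: wp_seq; apply: wp_blk; simregs.
  rewrite Hsrc E1' E2' addn1 addn2 (HA rl) //= !updrE /= Hl.
  rewrite (input_start HI' (ltnW Hkn)) (input_start HI' Hkn) adr_next // addKn.
  have EF : F k.+1 = F k + (l <= deg k).
    by rewrite /F hubs_take //; case: ifP => _; rewrite ?size_rcons ?addn1 ?addn0.
  apply: wp_if; rewrite !updrE /= => Hd.
    have Hd' : (l <= deg k) = false by lia.
    apply: wp_blk => /=; rewrite EF Hd' addn0; split=> //; lia.
  have Hd' : (l <= deg k) = true by lia.
  rewrite Hd' addn1 in EF.
  have HFn : F k < n by have := HFk k; lia.
  (* The hubs below [k] form a prefix of [hubs] of length [F k], so the hub [k] has index [F k]. *)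
  have Ek : nth 0 hubs (F k) = k.
    have /prefixP[q ->] := hubs_prefix Hkn.
    rewrite hubs_take // Hd' nth_cat size_rcons -/(F k) ltnSn nth_rcons -/(F k).
    by rewrite ltnn eqxx.
  apply: wp_seq.
  apply: (wp_mono (@BFS_spec n.+1 k (6 + F k) n _ _ _ HI' _ Hkn _ _ _ _ _)) => //.
    by move=> w Hw; rewrite HD' // ltnn.
  move=> t' R'' M'' HA'' [Ht' [[_ Hb] _ Hf'']].
  have [[En'' E1'' E2'' Ez''] _] : env R'' by apply: (env_agree HA'').
  have Ef : keeps (0 :: iota 6 n) M' M''.
    case: Hf'' => H1 H2; split=> // j i; rewrite inE negb_or mem_iota => /andP[j0 Hj] Hi.
    by apply: H2 => //; rewrite !inE negb_or j0; apply/eqP => E; move: Hj; rewrite E; lia.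
  apply: wp_blk; simregs; rewrite !(HA'' rnh) // !(HA'' rp) //= !updrE /= Hnh Hp E1'' En'' EF addn1.
  split=> //.
  + have := work_le N_sym N_lt n.+1 n Hkn; rewrite /C mulSn; lia.
  + by rewrite rowS.
  + move=> x w Hw; rewrite ltnS leq_eqVlt; case: (x =P F k) => [->|/eqP Hx] /=.
      by rewrite Hb // /hub_dist Ek.
    case: Hf'' => _ Hf''; rewrite Hf'' ?HD' //.
    by rewrite !inE eqn_add2l.
  + exact: keeps_trans Hf Ef.
- move=> t R' M' HA Hrj [Ht Hnh Hp HD' Hf]; split=> //; rewrite -/C; move: Ht; rewrite /F -/hubs; lia.
Qed.

(** * Computation of the types *)

Definition SAMEVEC : cmd :=
  For rx rnh
    (Seq (Blk [:: IAdd rT rd rv; ILoad ry rT; IAdd rT rd rrep; ILoad rc rT;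
                  ISub rw ry rc; ISub ry rc ry; IAdd rd rd rn])
    (Seq (If rw (Blk [:: IConst rg 1]) (Blk [::]))
         (If ry (Blk [:: IConst rg 1]) (Blk [::])))).

(** There is no early exit: the representatives have distinct types, so at most one matches. [rf]
    starts at the number of types, which stands for the absence of a match. *)
Definition FINDTYPE : cmd :=
  For ri rnt
    (Seq (Blk [:: IAdd rT bR ri; ILoad rrep rT; ISub rd bD rz; IConst rg 0;
                  IConst rx 0])
    (Seq SAMEVEC
         (If rg (Blk [::]) (Blk [:: ISub rf ri rz])))).

Definition TYPES : cmd :=
  Seq (Blk [:: IConst rnt 0; IConst rv 0])
    (For rv rn
      (Seq (Blk [:: ISub rf rnt rz; IConst ri 0])
      (Seq FINDTYPE
      (Seq (Blk [:: ISub rx rnt rf])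
      (Seq (If rx (Blk [::])
             (Blk [:: IAdd rT bR rnt; IStore rT rv; IAdd rnt rnt rone]))
           (Blk [:: IAdd rT bT rv; IStore rT rf; IAdd rT bC rf; ILoad ry rT;
                    IAdd ry ry rone; IStore rT ry])))))).

(** Two entries are equal iff their truncated differences in both directions vanish; [rg] records
    any failure. *)
Lemma samevec_spec v u R M : env R -> hub_rows (size hubs) M -> v < n -> u < n ->
  R rnh = size hubs -> R rx = 0 -> R rd = row 6 -> R rg = 0 -> R rv = v -> R rrep = u ->
  wp SAMEVEC R M (fun t R' M' =>
    [/\ t <= 20 * size hubs + 2, M' = M & (R' rg == 0) = (vec v == vec u)]).
Proof.
move=> HE HD Hv Hu Hnh Hx Hd Hg Hrv Hrep.
have [[En E1 E2 Ez] _] := HE.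
pose F k := all (fun x => hub_dist x v == hub_dist x u) (iota 0 k).
have FS k : F k.+1 = F k && (hub_dist k v == hub_dist k u).
  by rewrite /F -addn1 iotaD all_cat /= andbT.
apply: (@wp_for rx rnh _ _ _ 0 (size hubs) (20 * size hubs) (fun k t R' M' =>
  [/\ M' = M, t <= 20 * k, R' rd = row (6 + k) & (R' rg == 0) = F k])) => //=.
- by move=> k t R' M' Hk [_ Ht _ _]; lia.
- by rewrite !updrE /= Hg.
- move=> k t R' M' Hk HA Hrx [-> Ht Hd' Hg'].
  have [[En' E1' E2' Ez'] _] : env R' by apply: (env_agree HA).
  apply: wp_seq; apply: wp_blk; simregs.
  rewrite Hd' (HA rv) //= (HA rrep) //= Hrv Hrep !HD // En' rowS.
  have -> : k < size hubs by lia.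
  apply: wp_seq; apply: wp_if; simregs => H1; apply: wp_blk; simregs;
    apply: wp_if; simregs => H2; apply: wp_blk; simregs; split=> //; try lia;
    rewrite FS ?Hg' -?Hg'; case: (F k) => //=; apply/esym; try apply/eqP; try apply/negbTE/eqP; lia.
- move=> t R' M' HA Hrx [-> Ht _ ->]; split=> //; first by lia.
  rewrite /F /vec; elim: (iota _ _) => //= x r ->.
  by rewrite eqseq_cons.
Qed.

(** Sizes are recorded for all [t < n], so that a type which has not occurred yet has size 0 when
    its first vertex arrives. *)
Definition tables (i : nat) (M : store) : Prop :=
  [/\ forall t, t < size (reps i) -> M (row 3 + t) = nth 0 (reps i) t,
      forall w, w < i -> M (row 2 + w) = type_of i w
    & forall t, t < n -> M (row 4 + t) = count (fun w => type_of i w == t) (iota 0 i)].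

Lemma hub_rows_keeps (W : seq nat) nh M M' : {in W, forall j, j < 6} ->
  keeps W M M' -> hub_rows nh M -> hub_rows nh M'.
Proof.
move=> HW [_ H] HD x w Hw; rewrite H ?HD //.
by apply/negP => /HW.
Qed.

Lemma findtype_spec v R M : env R -> hub_rows (size hubs) M -> tables v M -> v < n ->
  R rnh = size hubs -> R rnt = size (reps v) -> R ri = 0 ->
  R rf = size (reps v) -> R rv = v ->
  wp FINDTYPE R M (fun t R' M' =>
    [/\ t <= size (reps v) * (20 * size hubs + 20) + 2, M' = M & R' rf = type_of v v]).
Proof.
move=> HE HD [Hr _ _] Hv Hnh Hnt Hi Hf Hrv.
have [[En E1 E2 Ez] _] := HE.
pose F k := if type_of v v < k then type_of v v else size (reps v).
have Hty : type_of v v <= size (reps v) by rewrite /type_of -(size_map vec) index_size.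
pose C := 20 * size hubs + 20.
have Hsz := reps_size v.
apply: (@wp_for ri rnt _ _ _ 0 (size (reps v)) (size (reps v) * C) (fun k t R' M' =>
  [/\ M' = M, t <= k * C & R' rf = F k])) => //=.
- by move=> k t R' M' Hk [_ Ht _]; nia.
- move=> k t R' M' Hk HA Hri [-> Ht HF].
  have Hks : k < size (reps v) by lia.
  have HE' : env R' by apply: (env_agree HA).
  have [[En' E1' E2' Ez'] [[_ _ _ EbR] [_ _ EbD]]] := HE'.
  set u := nth 0 (reps v) k.
  have Hu : u < n by apply: (@ltn_trans v) => //; apply: (@reps_lt v); rewrite mem_nth.
  apply: wp_seq; apply: wp_blk; simregs; rewrite EbR EbD Ez' Hri subn0 Hr // -/u.
  apply: wp_seq.
  apply: (wp_mono (@samevec_spec v u _ _ _ HD Hv Hu _ _ _ _ _ _)) => //=.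
  + by rewrite !updrE /= (HA rnh).
  + by rewrite !updrE /= (HA rv).
  move=> t' R'' M'' HA'' [Ht' -> Hg].
  have Ez'' : R'' rz = 0 by rewrite HA'' // !updrE.
  have Ei'' : R'' ri = k by rewrite HA'' // !updrE.
  have Ef'' : R'' rf = F k by rewrite HA'' // !updrE.
  have Hiff : (vec v == vec u) = (type_of v v == k).
    have Hn : vec u = nth [::] (map vec (reps v)) k by rewrite (nth_map 0).
    rewrite Hn /type_of; apply/eqP/eqP => [->|Ei].
      by rewrite index_uniq ?reps_uniq ?size_map.
    by rewrite -Ei nth_index // -index_mem Ei size_map.
  rewrite Hiff in Hg; rewrite /C in Ht *.
  apply: wp_if; simregs => H1; apply: wp_blk; simregs; rewrite ?Ei'' ?Ez'' ?Ef'' ?subn0; split=> //; try lia;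
    move: Hg; case: eqP => // H2 /esym/eqP H3; rewrite /F.
  + by have -> : (type_of v v < k.+1) = (type_of v v < k) by lia.
  + by rewrite H3 ltnSn.
- move=> t R' M' HA Hri [-> Ht ->]; split=> //; first by rewrite -/C; lia.
  by rewrite /F; case: ltnP => //; lia.
Qed.

Lemma types_spec R M : env R -> hub_rows (size hubs) M -> R rnh = size hubs ->
  (forall t, t < n -> M (row 4 + t) = 0) ->
  wp TYPES R M (fun t R' M' =>
    [/\ t <= n * (size (reps n) * (20 * size hubs + 20) + 30) + 4,
        R' rnt = size (reps n), tables n M' & keeps [:: 2; 3; 4] M M']).
Proof.
move=> HE HD Hnh H0.
have [[En E1 E2 Ez] _] := HE.
pose C := size (reps n) * (20 * size hubs + 20) + 30.
apply: wp_seq; apply: wp_blk; simregs.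
apply: (@wp_for rv rn _ _ _ 0 n (n * C) (fun k t R' M' =>
  [/\ t <= k * C, R' rnt = size (reps k), tables k M' & keeps [:: 2; 3; 4] M M'])) => //.
- by move=> k t R' M' Hk [Ht _ _ _]; nia.
- move=> v t R' M' Hk HA Hrv [Ht Hnt HT Hf].
  have Hv : v < n by lia.
  have HE' : env R' by apply: (env_agree HA).
  have [[En' E1' E2' Ez'] _] := HE'.
  have HD' : hub_rows (size hubs) M'.
    by apply: hub_rows_keeps Hf HD => j; rewrite !inE => /or3P[] /eqP ->.
  have Hnh' : R' rnh = size hubs by rewrite HA.
  have Hsz := reps_size v.
  have Hmono : size (reps v) * (20 * size hubs + 20) <= size (reps n) * (20 * size hubs + 20).
    by rewrite leq_mul2r reps_size_mono ?orbT // ltnW.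
  apply: wp_seq; apply: wp_blk; simregs; rewrite Ez' Hnt subn0.
  apply: wp_seq.
  apply: (wp_mono (@findtype_spec v _ _ _ HD' HT Hv _ _ _ _ _)) => //.
  move=> t1 R1 M1 HA1 [Ht1 -> Hrf].
  have HE1 : env R1 by apply: (env_agree HA1).
  have [[En1 E11 E21 Ez1] [[_ _ EbT EbR] [EbC _ _]]] := HE1.
  have Hnt1 : R1 rnt = size (reps v) by rewrite HA1.
  have Hrv1 : R1 rv = v by rewrite HA1.
  set f := type_of v v in Hrf.
  have Hfl : f <= size (reps v) by rewrite /f /type_of -(size_map vec) index_size.
  have Hfn : f < n by lia.
  apply: wp_seq; apply: wp_blk; simregs; rewrite Hnt1 Hrf.
  have Hnew : (vec v \in map vec (reps v)) = (f < size (reps v)).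
    by rewrite -index_mem size_map.
  have [HTr HTt HTc] := HT.
  (* The memory after a new representative has possibly been stored, after the type of [v] has been
     stored, and after the size of that type has been increased. *)
  pose M2 := if f < size (reps v) then M' else updm M' (row 3 + size (reps v)) v.
  pose M3 := updm M2 (row 2 + v) f.
  pose M4 := updm M3 (row 4 + f) (M3 (row 4 + f)).+1.
  have Hf2 : keeps [:: 2; 3; 4] M' M4.
    apply: (@keeps_trans _ _ M3); last exact: keeps_upd.
    apply: (@keeps_trans _ _ M2); last exact: keeps_upd.
    rewrite /M2; case: ifP => _; first exact: keeps_refl.
    by apply: keeps_upd => //; lia.
  have HT4 : tables v.+1 M4.
    have Hszn : size (reps v) < n by lia.
    split=> [i Hi|w Hw|i Hi].
    - have Hin : i < n by have := reps_size v.+1; lia.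
      rewrite /M4 /M3 !cellE //= /M2 /=; move: Hi; rewrite /= Hnew.
      case: ifP => Hfs; first exact: HTr.
      rewrite size_rcons ltnS leq_eqVlt nth_rcons cellE //= => /orP[/eqP ->|Hi].
        by rewrite eqxx ltnn.
      by rewrite Hi ltn_eqF // HTr.
    - have Hwn : w < n by lia.
      rewrite /M4 /M3 !cellE //=; case: eqP => [->|Hne]; first by rewrite type_of_new.
      have Hwv : w < v by lia.
      rewrite type_ofS // /M2; case: ifP => Hfs; first exact: HTt.
      by rewrite cellE //= HTt.
    - have Hc : count (fun w => type_of v.+1 w == i) (iota 0 v.+1)
          = count (fun w => type_of v w == i) (iota 0 v) + (f == i).
        rewrite count_iotaS type_of_new; congr (_ + _); apply: eq_in_count => w.
        by rewrite mem_iota => /andP[_ Hw]; rewrite type_ofS.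
      rewrite Hc /M4 /M3 !cellE //= (eq_sym f).
      have E0 x : x < n -> M2 (row 4 + x) = M' (row 4 + x).
        by move=> Hx; rewrite /M2; case: ifP => // _; rewrite cellE.
      by case: eqP => [->|_]; rewrite E0 // HTc // ?addn1 ?addn0.
  have Hnt4 : size (reps v.+1) = size (reps v) + (size (reps v) <= f).
    rewrite /= Hnew; case: ltnP => H; rewrite ?size_rcons ?addn1 ?addn0 //.
  apply: wp_seq; apply: wp_if; simregs => Hx; apply: wp_blk; simregs.
    have Hlt : f < size (reps v) by lia.
    apply: wp_blk; simregs; rewrite EbT EbC Hrf Hrv1 E11 addn1.
    have -> : M' = M2 by rewrite /M2 Hlt.
    split=> //; first by rewrite mulSn /C; lia.
    + by rewrite Hnt1 Hnt4; lia.
    + exact: keeps_trans Hf Hf2.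
  have Hlt : (f < size (reps v)) = false by lia.
  apply: wp_blk; simregs; rewrite EbT EbC EbR Hrf Hrv1 Hnt1 E11 !addn1.
  have -> : updm M' (row 3 + size (reps v)) v = M2 by rewrite /M2 Hlt.
  split=> //; first by rewrite mulSn /C; lia.
  + by move: Hnt4 => /= ->; lia.
  + exact: keeps_trans Hf Hf2.
- by move=> t R' M' HA Hrv [Ht ? ? ?]; split=> //; rewrite -/C; lia.
Qed.

(** * The test for one vertex *)

Definition VIA : cmd :=
  For rx rnh
    (Seq (Blk [:: IAdd rT rd rv; ILoad ry rT; IAdd rT rd rrep; ILoad rc rT;
                  IAdd rT ry rc; ISub rT rT rk2; ISub ry rone rT; IAdd rd rd rn])
         (If ry (Blk [:: IConst rg 1]) (Blk [::]))).

Definition GOOD : cmd :=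
  For ri rnt
    (Seq (Blk [:: IAdd rT bR ri; ILoad rrep rT; ISub rd bD rz; IConst rg 0;
                  IConst rx 0])
    (Seq VIA
    (Seq (Blk [:: IAdd rT bG ri; IStore rT rg])
         (If rg (Blk [:: IAdd rT bC ri; ILoad ry rT; ISub rrem rrem ry])
             (Blk [::]))))).

(** Clearing marks along the queue costs no more than setting them. A vertex whose type is flagged
    was subtracted together with its type and must not be counted twice. *)
Definition SWEEP : cmd :=
  For ri rtail
    (Seq (Blk [:: IAdd rT bQ ri; ILoad rw rT; IAdd rT bT rw; ILoad ry rT;
                  IAdd rT bG ry; ILoad ry rT; IAdd rT bM rw; IStore rT rz])
         (If ry (Blk [::]) (Blk [:: ISub rrem rrem rone]))).

Definition CHECK : cmd :=
  Seq (Blk [:: ISub rrem rn rz; IConst ri 0])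
  (Seq GOOD
  (Seq (Blk [:: ISub rp bM rz; ISub rth rl rz; ISub rlim rk rz; ISub rsrc rv rz])
  (Seq BFS
  (Seq (Blk [:: IConst ri 0])
  (Seq SWEEP
       (If rrem (Blk [:: IConst rbad 1]) (Blk [::]))))))).

(** With the truncated difference of the sum of both marks and [k.+2] in [rT], the value [1 - rT] is
    nonzero iff the sum is at most [k.+2]. The sum is formed in [rT], the only register in which two
    arbitrary values may be added. *)
Lemma via_spec k v u R M : env R -> hub_rows (size hubs) M -> v < n -> u < n ->
  R rnh = size hubs -> R rx = 0 -> R rd = row 6 -> R rg = 0 -> R rv = v ->
  R rrep = u -> R rk2 = k.+2 ->
  wp VIA R M (fun t R' M' =>
    [/\ t <= 20 * size hubs + 2, M' = M & R' rg = via k v u]).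
Proof.
move=> HE HD Hv Hu Hnh Hx Hd Hg Hrv Hrep Hk2.
have [[En E1 E2 Ez] _] := HE.
pose F i := has (fun x => hub_dist x v + hub_dist x u <= k.+2) (iota 0 i).
have FS i : F i.+1 = F i || (hub_dist i v + hub_dist i u <= k.+2).
  by rewrite /F -(addn1 i) iotaD has_cat /= orbF.
apply: (@wp_for rx rnh _ _ _ 0 (size hubs) (20 * size hubs) (fun i t R' M' =>
  [/\ M' = M, t <= 20 * i, R' rd = row (6 + i) & R' rg = F i])) => //=.
- by move=> i t R' M' Hi [_ Ht _ _]; lia.
- move=> i t R' M' Hi HA Hrx [-> Ht Hd' Hg'].
  have [[En' E1' E2' Ez'] _] : env R' by apply: (env_agree HA).
  apply: wp_seq; apply: wp_blk; simregs.
  rewrite Hd' (HA rv) //= (HA rrep) //= (HA rk2) //= Hrv Hrep Hk2 !HD // En' E1' rowS.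
  have -> : i < size hubs by lia.
  apply: wp_if; simregs => H1; apply: wp_blk; simregs; split=> //; try lia;
    rewrite FS ?Hg'; case: (F i) => //=; lia.
- by move=> t R' M' HA Hrx [-> Ht _ ->]; split=> //; lia.
Qed.

Lemma tables_keeps (W : seq nat) i M M' : i <= n ->
  all (fun j => j \notin W) [:: 2; 3; 4] -> keeps W M M' -> tables i M -> tables i M'.
Proof.
move=> Hi /and4P[W2 W3 W4 _] [_ H] [Hr Ht Hc]; have Hsz := reps_size i.
split=> [t H1|w H1|t H1]; rewrite H ?Hr ?Ht ?Hc //; lia.
Qed.

Lemma good_spec k v R M : env R -> hub_rows (size hubs) M -> tables n M -> v < n ->
  R rnh = size hubs -> R rnt = size (reps n) -> R ri = 0 -> R rrem = n -> R rv = v ->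
  R rk2 = k.+2 ->
  wp GOOD R M (fun t R' M' =>
    [/\ t <= size (reps n) * (20 * size hubs + 40) + 2,
        forall w, w < n -> M' (row 5 + type_of n w) = good k v w,
        R' rrem = n - count (good k v) (iota 0 n) & keeps [:: 5] M M']).
Proof.
move=> HE HD HT Hv Hnh Hnt Hi Hrem Hrv Hk2.
have [[En E1 E2 Ez] _] := HE.
have Hsz := reps_size n.
pose nt := size (reps n); pose C := 20 * size hubs + 40.
pose g t := via k v (nth 0 (reps n) t).
(* Vertices are counted rather than types, so that the last value is the number of all [w] with
   [good k v w]. *)
pose F i := count (fun w => (type_of n w < i) && g (type_of n w)) (iota 0 n).
apply: (@wp_for ri rnt _ _ _ 0 nt (nt * C) (fun i t R' M' =>
  [/\ t <= i * C, forall j, j < i -> M' (row 5 + j) = g j,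
      R' rrem = n - F i & keeps [:: 5] M M'])) => //=.
- by move=> i t R' M' Hi' [Ht _ _ _]; nia.
- split=> //; rewrite !updrE /= Hrem /F.
  by rewrite (@eq_count _ _ pred0) ?count_pred0 ?subn0.
- move=> i t R' M' Hi' HA Hri [Ht Hg HF Hf].
  have Hks : i < nt by lia.
  have Hin : i < n by rewrite /nt in Hks; lia.
  have HE' : env R' by apply: (env_agree HA).
  have [[En' E1' E2' Ez'] [[_ _ _ EbR] [_ _ EbD]]] := HE'.
  have HD' : hub_rows (size hubs) M' by apply: hub_rows_keeps Hf HD => j; rewrite !inE => /eqP ->.
  have HT' : tables n M' by apply: tables_keeps Hf HT.
  have [HTr _ HTc] := HT'.
  set u := nth 0 (reps n) i.
  have Hu : u < n by apply: (@reps_lt n); rewrite mem_nth.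
  apply: wp_seq; apply: wp_blk; simregs; rewrite EbR EbD Ez' Hri subn0 HTr // -/u.
  apply: wp_seq.
  apply: (wp_mono (@via_spec k v u _ _ _ HD' Hv Hu _ _ _ _ _ _ _)) => //=.
  + by rewrite !updrE /= (HA rnh).
  + by rewrite !updrE /= (HA rv).
  + by rewrite !updrE /= (HA rk2).
  move=> t' R'' M'' HA'' [Ht' -> Hgi].
  rewrite -/(g i) in Hgi.
  have [[En'' E1'' E2'' Ez''] [[_ _ _ EbR''] [EbC EbG EbD'']]] : env R''.
    by apply: (env_agree HA'') => //; rewrite /env !updrE.
  have Ei'' : R'' ri = i by rewrite HA'' // !updrE.
  have Er'' : R'' rrem = n - F i by rewrite HA'' // !updrE.
  have FS : F i.+1 = F i + g i * count (fun w => type_of n w == i) (iota 0 n).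
    have -> : g i * count (fun w => type_of n w == i) (iota 0 n)
        = count (fun w => (type_of n w == i) && g i) (iota 0 n).
      case: (g i); first by rewrite mul1n; apply: eq_count => w; rewrite andbT.
      by rewrite mul0n (@eq_count _ _ pred0) ?count_pred0 // => w; rewrite andbF.
    apply: count_disjoint => w.
      by rewrite ltnS leq_eqVlt orbC; case: eqP => [->|]; rewrite ?ltnn ?orbF.
    by case: (type_of n w =P i) => [->|]; rewrite ?ltnn ?andbF.
  have Hf2 : keeps [:: 5] M (updm M' (row 5 + i) (g i)).
    by apply: keeps_trans Hf (keeps_upd _ _ _ _).
  have Hg2 j : j < i.+1 -> updm M' (row 5 + i) (g i) (row 5 + j) = g j.
    move=> Hj; rewrite cellE //=; last by lia.
    by case: eqP => [-> //|Hne]; rewrite Hg //; lia.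
  apply: wp_seq; apply: wp_blk; simregs; rewrite EbG Ei'' Hgi.
  apply: wp_if; simregs; rewrite Hgi => H1; apply: wp_blk; simregs;
    rewrite ?EbC ?Ei'' ?cellE // ?HTc // Er'' FS /C in Ht *; split=> //; try lia.
  by case: (g i) H1 => //= _; rewrite ?mul1n ?mul0n; lia.
- move=> t R' M' HA Hri [Ht Hg HF Hf]; split=> //; first by rewrite -/nt -/C; lia.
    by move=> w Hw; rewrite Hg //; apply: type_of_lt.
  rewrite HF; congr (n - _); apply: eq_in_count => w; rewrite mem_iota => /andP[_ Hw].
  by rewrite /nt type_of_lt.
Qed.

Lemma sweep_spec k v st rem R M : env R -> tables n M -> wf_queue st -> stored 1 st M ->
  (forall w, w < n -> M (row 5 + type_of n w) = good k v w) ->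
  R rtail = size st.1 -> R ri = 0 -> R rrem = rem ->
  wp SWEEP R M (fun t R' M' =>
    [/\ t <= 20 * size st.1 + 2, forall w, w < n -> M' (row 1 + w) = 0,
        R' rrem = rem - count (predC (good k v)) st.1 & keeps [:: 1] M M']).
Proof.
move=> HE HT [Hm Hu Hl] [Hq Hmk] Hg Htail Hi Hrem.
have [[En E1 E2 Ez] _] := HE.
pose F i := count (predC (good k v)) (take i st.1).
apply: (@wp_for ri rtail _ _ _ 0 (size st.1) (20 * size st.1) (fun i t R' M' =>
  [/\ t <= 20 * i, forall w, w < n -> M' (row 1 + w) = if w \in take i st.1 then 0 else st.2 w,
      R' rrem = rem - F i & keeps [:: 1] M M'])) => //=.
- by move=> i t R' M' Hi' [Ht _ _ _]; lia.
- split=> //; first by move=> w Hw; rewrite take0 Hmk.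
  by rewrite !updrE /= Hrem /F take0 subn0.
- move=> i t R' M' Hi' HA Hri [Ht Hz HF Hf].
  have Hks : i < size st.1 := Hi'.
  have HE' : env R' by apply: (env_agree HA).
  have [[En' E1' E2' Ez'] [[EbQ EbM EbT _] [_ EbG _]]] := HE'.
  set w := nth 0 st.1 i.
  have Hw : w < n by apply: Hl; rewrite mem_nth.
  have [_ HTt _] : tables n M' by apply: tables_keeps Hf HT.
  have HQ : M' (row 0 + i) = w.
    case: Hf => _ Hf; rewrite Hf ?Hq //.
    have : size st.1 <= size (iota 0 n).
      by apply: uniq_leq_size => // x /Hl; rewrite mem_iota.
    by rewrite size_iota; apply: leq_trans.
  have HG : M' (row 5 + type_of n w) = good k v w.
    have := type_of_lt Hw; have := reps_size n => H1 H2.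
    by case: Hf => _ Hf; rewrite Hf ?Hg //; lia.
  have FS : F i.+1 = F i + ~~ good k v w.
    by rewrite /F (take_nth 0) // -cats1 count_cat /= addn0.
  apply: wp_seq; apply: wp_blk; simregs; rewrite EbQ Hri HQ EbT HTt // EbG HG EbM Ez'.
  have Hz2 x : x < n -> updm M' (row 1 + w) 0 (row 1 + x)
      = if x \in take i.+1 st.1 then 0 else st.2 x.
    move=> Hx; rewrite cellE //= (take_nth 0) // mem_rcons inE -/w.
    by case: eqP => //= _; rewrite Hz.
  have Hf2 : keeps [:: 1] M (updm M' (row 1 + w) 0).
    by apply: keeps_trans Hf (keeps_upd _ _ _ _).
  apply: wp_if; simregs => H1; apply: wp_blk; simregs; rewrite ?E1' HF FS; split=> //; try lia;
    by case: (good k v w) H1 => //; lia.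
- move=> t R' M' HA Hri; rewrite /F take_size => -[Ht Hz HF Hf]; split=> //; first lia.
  move=> w Hw; rewrite Hz //; case: ifP => // /negbT; rewrite -Hm => /negPn/eqP //.
Qed.

Lemma check_spec k v R M : env R -> input M -> hub_rows (size hubs) M -> tables n M -> v < n ->
  (forall w, w < n -> M (row 1 + w) = 0) ->
  R rnh = size hubs -> R rnt = size (reps n) -> R rv = v -> R rk = k ->
  R rk2 = k.+2 -> R rl = l ->
  wp CHECK R M (fun t R' M' =>
    [/\ t <= size (reps n) * (20 * size hubs + 40) + 30 * work N l v k + 10 * k
          + 20 * size (bfs N l v k).2.1 + 60,
        forall w, w < n -> M' (row 1 + w) = 0,
        R' rbad = if covered k v then R rbad else 1 & keeps [:: 0; 1; 5] M M']).
Proof.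
move=> HE HI HD HT Hv Hz Hnh Hnt Hrv Hrk Hk2 Hrl.
have [[En E1 E2 Ez] _] := HE.
apply: wp_seq; apply: wp_blk; simregs; rewrite En Ez subn0.
apply: wp_seq.
apply: (wp_mono (@good_spec k v _ _ _ HD HT Hv _ _ _ _ _ _)) => //.
move=> t1 R1 M1 HA1 [Ht1 Hg1 Hrem1 Hf1].
have [[En1 E11 E21 Ez1] [[EbQ1 EbM1 _ _] _]] : env R1 by apply: (env_agree HA1).
apply: wp_seq; apply: wp_blk; simregs; rewrite Ez1 !subn0 EbM1.
have HI1 : input M1 := input_keeps Hf1 HI.
have HT1 : tables n M1 by apply: tables_keeps Hf1 HT.
apply: wp_seq.
apply: (wp_mono (@BFS_spec l v 1 k _ _ _ HI1 _ Hv _ _ _ _ _)) => //=.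
- by apply: (env_agree HA1).
- by move=> w Hw; case: Hf1 => _ ->; rewrite // Hz.
- by rewrite !updrE /= (HA1 rv).
- by rewrite !updrE /= (HA1 rk).
- by rewrite !updrE /= (HA1 rl).
move=> t2 R2 M2 HA2 [Ht2 [Hb2 Htail2 Hf2]].
have [[En2 E12 E22 Ez2] _] : env R2.
  by apply: (env_agree HA2) => //; apply: (env_agree HA1).
apply: wp_seq; apply: wp_blk; simregs.
have HT2 : tables n M2 by apply: tables_keeps Hf2 HT1.
have [Hu Hm Hmem _ _ _] := bfsP N_sym l v k.
have Hwf : wf_queue (bfs N l v k).2.
  by split=> // u; exact: (bfs_lt N_sym N_lt).
apply: wp_seq.
apply: (wp_mono (@sweep_spec k v (bfs N l v k).2 (n - count (good k v) (iota 0 n)) _ _ _ HT2 Hwf Hb2 _ _ _ _)) => //=.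
- by apply: (env_agree HA2) => //; apply: (env_agree HA1).
- move=> w Hw; case: Hf2 => _ ->; rewrite ?Hg1 //.
  by have := type_of_lt Hw; have := reps_size n; lia.
- by rewrite !updrE /= HA2 // !updrE /= Hrem1.
move=> t3 R3 M3 HA3 [Ht3 Hz3 Hrem3 Hf3].
have Hbad3 : R3 rbad = R rbad.
  by rewrite HA3 // !updrE /= HA2 // !updrE /= HA1 // !updrE.
have Hf : keeps [:: 0; 1; 5] M M3.
  have Hsub (W : seq nat) A B : {subset W <= [:: 0; 1; 5]} -> keeps W A B -> keeps [:: 0; 1; 5] A B.
    move=> HW [H1 H2]; split=> // j i Hj; apply: H2; apply: contra Hj; exact: HW.
  apply: (@keeps_trans _ _ M1); first by apply: Hsub Hf1 => j; rewrite !inE => ->; rewrite !orbT.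
  apply: (@keeps_trans _ _ M2); first by apply: Hsub Hf2 => j; rewrite !inE orbA => ->.
  by apply: Hsub Hf3 => j; rewrite !inE => ->; rewrite orbT.
(* With truncated subtraction the counter is 0 iff the two disjoint counts add up to at least [n],
   that is, iff every vertex is covered. The queue enumerates the ball without repetition, so
   counting in it counts vertices. *)
have Hcov : covered k v = (R3 rrem == 0).
  rewrite Hrem3 -subnDA subn_eq0.
  have -> : count (predC (good k v)) (bfs N l v k).2.1
      = count (fun w => ~~ good k v w && ball N l v k w) (iota 0 n).
    have Hp : perm_eq (bfs N l v k).2.1 (filter (ball N l v k) (iota 0 n)).
      apply: uniq_perm => //; first by rewrite filter_uniq ?iota_uniq.
      move=> w; rewrite mem_filter Hmem mem_iota /= add0n.
      case B: (ball N l v k w) => //=; apply/esym.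
      exact: (ball_lt N_sym N_lt Hv B).
    by rewrite (permP Hp) count_filter.
  rewrite -(@count_disjoint _ _ _ (fun w => good k v w || ball N l v k w)).
  - rewrite /covered all_count size_iota eqn_leq -{2}(size_iota 0 n) count_size.
    by [].
  - by move=> w; case: (good k v w).
  - by move=> w; case: (good k v w).
apply: wp_if => Hr; apply: wp_blk; simregs; split=> //; try lia.
by rewrite Hcov; case: eqP.
Qed.

(** * The search for the diameter *)

Definition SEARCH : cmd :=
  Seq (Blk [:: IConst rk 0; IConst rk2 2; IConst rbad 1])
    (While rbad
      (Seq (Blk [:: IConst rbad 0; IConst rv 0])
      (Seq (For rv rn CHECK)
           (If rbad (Blk [:: IAdd rk rk rone; IAdd rk2 rk2 rone]) (Blk [::]))))).

Definition check_cost (k v : nat) : nat :=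
  size (reps n) * (20 * size hubs + 40) + 30 * work N l v k + 10 * k
    + 20 * size (bfs N l v k).2.1 + 60.

Lemma search_spec d K R M : env R -> input M -> hub_rows (size hubs) M -> tables n M ->
  (forall w, w < n -> M (row 1 + w) = 0) ->
  R rnh = size hubs -> R rnt = size (reps n) -> R rl = l ->
  (forall k, k <= d -> all_covered k n = (k == d)) ->
  (forall k v, k <= d -> v < n -> check_cost k v <= K) ->
  wp SEARCH R M (fun t R' M' =>
    t <= d.+1 * (n * (K + 4) + 20) + 10 /\ R' rk = d).
Proof.
move=> HE HI HD HT Hz Hnh Hnt Hrl Hd HK.
have [[En E1 E2 Ez] _] := HE.
pose X := n * (K + 4) + 20.
have HsubD W A B : all (fun j => j < 6) W -> keeps W A B -> hub_rows (size hubs) A -> hub_rows (size hubs) B.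
  by move=> HW Hf HA; apply: hub_rows_keeps Hf HA; apply/allP.
apply: wp_seq; apply: wp_blk; simregs.
(* At the loop test [rbad = 0] means that round [k] has succeeded, so [k.+1] rounds are paid for;
   otherwise round [k] is still to come. *)
apply: (@wp_while _ _ _ _ (d.+1 * X) (fun t R' M' => exists k,
  [/\ R' rk = k, R' rk2 = k.+2, k <= d & keeps [:: 0; 1; 5] M M'] /\
  (forall w, w < n -> M' (row 1 + w) = 0) /\
  if R' rbad == 0 then t <= k.+1 * X /\ k = d else t <= k * X)).
- move=> t R' M' [k [[_ _ Hk _] [_]]]; have := leq_mul Hk (leqnn X); rewrite mulSn.
  by case: ifP => _ H1 H2; nia.
- by exists 0; simregs; split.
- move=> t R' M' HA [k [[Hrk Hrk2 Hk Hf] [Hz' H]]] Hbad.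
  have HE' : env R' by apply: (env_agree HA).
  have [[En' E1' E2' Ez'] _] := HE'.
  have Ht : t <= k * X by move: H; case: eqP.
  apply: wp_seq; apply: wp_blk; simregs.
  apply: wp_seq.
  apply: (@wp_for rv rn _ _ _ 0 n (n * (K + 4)) (fun i t' R'' M'' =>
    [/\ t' <= i * (K + 4), forall w, w < n -> M'' (row 1 + w) = 0,
        R'' rbad = ~~ all_covered k i & keeps [:: 0; 1; 5] M M''])) => //=.
  + by move=> i t' R'' M'' Hi [Ht' _ _ _]; nia.
  + move=> i t' R'' M'' Hi HA' Hrv [Ht' Hz'' Hb Hf''].
    have Hin : i < n := Hi.
    have HE'' : env R'' by apply: (env_agree HA').
    have HI'' := input_keeps Hf'' HI.
    have HD'' : hub_rows (size hubs) M'' by apply: HsubD Hf'' HD.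
    have HT'' : tables n M'' by apply: tables_keeps Hf'' HT.
    apply: (wp_mono (@check_spec k i _ _ HE'' HI'' HD'' HT'' Hin Hz'' _ _ Hrv _ _ _)).
    * by rewrite (HA' rnh) //= !updrE /= (HA rnh).
    * by rewrite (HA' rnt) //= !updrE /= (HA rnt).
    * by rewrite (HA' rk) //= !updrE.
    * by rewrite (HA' rk2) //= !updrE.
    * by rewrite (HA' rl) //= !updrE /= (HA rl).
    move=> t1 R1 M1 HA1 [Ht1 Hz1 Hb1 Hf1].
    split=> //.
    * have := HK k i Hk Hin; rewrite /check_cost mulSn; lia.
    * rewrite !updrE /= Hb1 Hb all_coveredS.
      by case: (covered k i); rewrite ?andbT ?andbF.
    * exact: keeps_trans Hf'' Hf1.
  move=> t' R'' M'' HA' _ [Ht' Hz'' Hb Hf''].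
  have [[En'' E1'' E2'' Ez''] _] : env R'' by apply: (env_agree HA').
  have Hrk'' : R'' rk = k by rewrite (HA' rk) //= !updrE.
  have Hrk2'' : R'' rk2 = k.+2 by rewrite (HA' rk2) //= !updrE.
  rewrite Hd // in Hb.
  apply: wp_if => Hb'; apply: wp_blk; simregs.
    have Hne : k <> d by move=> E; move: Hb'; rewrite Hb E eqxx.
    exists k.+1; simregs; rewrite Hrk'' Hrk2'' E1'' !addn1; split; first by split=> //; lia.
    split=> //; rewrite Hb; case: (k =P d) => // _ /=.
    by rewrite mulSn /X; lia.
  have He : k = d by move: Hb'; rewrite Hb; case: eqP.
  exists k; rewrite Hrk'' Hrk2'' Hb' /=; split=> //; split=> //; split=> //.
  by rewrite mulSn /X; lia.
- move=> t R' M' HA [k [[Hrk Hrk2 Hk Hf] [Hz' H]]] Hbad.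
  move: H; rewrite Hbad eqxx => -[Ht Hkd]; split; last by rewrite Hrk.
  rewrite -/X; by move: Ht; rewrite Hkd; lia.
Qed.

(** Separated from [THRESHOLD] because its specification depends on the threshold [l], which is
    known only at run time. *)
Definition REST : cmd := Seq HUBROWS (Seq TYPES SEARCH).

Lemma rest_spec d K R M : env R -> input M -> R rl = l ->
  (forall j i, i < n -> M (row j + i) = 0) ->
  (forall k, k <= d -> all_covered k n = (k == d)) ->
  (forall k v, k <= d -> v < n -> check_cost k v <= K) ->
  wp REST R M (fun t R' M' =>
    t <= 20 * n + size hubs * (30 * (\sum_(0 <= u < n) (deg u).+1) + 10 * n + 50)
       + n * (size (reps n) * (20 * size hubs + 20) + 30)
       + d.+1 * (n * (K + 4) + 20) + 40 /\ R' rk = d).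
Proof.
move=> HE HI Hrl H0 Hd HK.
apply: wp_seq; apply: (wp_mono (hubrows_spec HE HI Hrl _)).
  by move=> x w Hw; rewrite H0.
move=> t1 R1 M1 HA1 [Ht1 Hnh1 HD1 Hf1].
have HE1 : env R1 by apply: (env_agree HA1).
have HI1 := input_keeps Hf1 HI.
have H0' j i : 0 < j < 6 -> i < n -> M1 (row j + i) = 0.
  by move=> Hj Hi; case: Hf1 => _ ->; rewrite ?H0 // inE mem_iota; lia.
apply: wp_seq; apply: (wp_mono (types_spec HE1 HD1 Hnh1 _)).
  by move=> t Ht; rewrite H0'.
move=> t2 R2 M2 HA2 [Ht2 Hnt2 HT2 Hf2].
have HE2 : env R2 by apply: (env_agree HA2).
have HI2 := input_keeps Hf2 HI1.
apply: (wp_mono (@search_spec d K _ _ HE2 HI2 _ HT2 _ _ Hnt2 _ Hd HK)).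
- by apply: hub_rows_keeps Hf2 HD1; apply/allP.
- by move=> w Hw; case: Hf2 => _ ->; rewrite ?H0'.
- by rewrite HA2.
- by rewrite HA2 // HA1.
by move=> t3 R3 M3 _ [Ht3 Hk]; split=> //; lia.
Qed.

Definition ALG : cmd := Seq THRESHOLD REST.

End Machine.

(** * Distances through hubs *)

Section Distances.

Variables (n : nat) (N : nat -> seq nat).
Hypothesis N_sym : forall u w, (w \in N u) = (u \in N w).
Hypothesis N_lt : forall u w, w \in N u -> w < n.
Hypothesis N_deg : forall u, size (N u) <= n.
Notation deg u := (size (N u)).

Definition adj : rel nat := fun u w => w \in N u.

Definition near (k u w : nat) : Prop :=
  exists p, [/\ path adj u p, last u p = w & size p <= k].

Lemma ballP th s i w :
  reflect (exists p, [/\ path adj s p, last s p = w, size p <= i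
             & all (fun u => deg u < th) (s :: p)])
          (ball N th s i w).
Proof.
apply: (iffP idP).
- elim: i w => [|i IH] w /=.
    by case/andP=> /eqP -> Hd; exists [::]; rewrite /= Hd.
  case/orP=> [/IH[p [? ? ? ?]]|/andP[Hd /hasP[u uw /IH[p [Hp Hl Hs Ha]]]]].
    by exists p; split=> //; lia.
  exists (rcons p w); rewrite rcons_path Hp Hl last_rcons size_rcons /adj N_sym.
  by rewrite all_rcons Hd; move: Ha => /= /andP[-> ->].
- case=> p; elim/last_ind: p i w => [|p x IH] i w.
    case=> _ /= <- _ /andP[Hd _]; apply: (@ball_mono N th s 0) => //=.
    by rewrite eqxx.
  rewrite rcons_path last_rcons size_rcons -rcons_cons all_rcons.
  case=> /andP[Hp Hx] <- Hs /andP[Hd Ha].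
  case: i Hs => // i Hs /=; rewrite Hd; apply/orP; right; apply/hasP.
  exists (last s p); first by rewrite N_sym.
  by apply: IH.
Qed.

Lemma near_sym k u w : near k u w -> near k w u.
Proof.
case=> p; elim: p k u => [|y p IH] k u /= [].
  by move=> _ <- _; exists [::].
case/andP=> uy Hp Hl; case: k => // k Hs.
have [q [Hq Hlq Hsq]] := IH k y (And3 Hp Hl Hs).
exists (rcons q u); rewrite rcons_path last_rcons size_rcons Hq Hlq /adj N_sym.
by split.
Qed.

Lemma near_trans i j u v w : near i u v -> near j v w -> near (i + j) u w.
Proof.
case=> p [Hp Hl Hs] [q [Hq Hlq Hsq]]; exists (p ++ q).
by rewrite cat_path last_cat size_cat Hp Hl Hq Hlq leq_add.
Qed.

Lemma near_lt k u w : u < n -> near k u w -> w < n.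
Proof.
move=> Hu [p [Hp <- _]]; elim: p u Hu Hp => //= y p IH u Hu /andP[uy].
by apply: IH; apply: N_lt uy.
Qed.

Lemma ball_full s i w : ball N n.+1 s i w <-> near i s w.
Proof.
split=> [/ballP[p [? ? ? _]]|[p [? ? ?]]]; first by exists p.
by apply/ballP; exists p; split=> //; apply/allP => u _; rewrite ltnS.
Qed.

Variable d : nat.
Hypothesis d_le : d <= n.
Hypothesis near_d : forall u w, u < n -> w < n -> near d u w.

Lemma near_mono i j u w : i <= j -> near i u w -> near j u w.
Proof. by move=> ij [p [? ? Hs]]; exists p; split=> //; apply: leq_trans ij. Qed.

Variable l : nat.
Notation hubs := (hubs n N l).
Notation hub_dist := (hub_dist n N l).
Notation reps := (reps n N l).

Lemma hub_lt x : x < size hubs -> nth 0 hubs x < n.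
Proof.
move=> Hx; have := mem_nth 0 Hx; rewrite mem_filter mem_iota.
by case/andP=> _ /andP[].
Qed.

(** The full search runs [n >= d] levels and so marks every vertex. For radii beyond [n] both sides
    hold because all distances are at most [d]. *)
Lemma hub_dist_near x w i : x < size hubs -> w < n -> (hub_dist x w <= i.+1) <-> near i (nth 0 hubs x) w.
Proof.
move=> Hx Hw; set y := nth 0 hubs x.
have HB j : j <= n -> (0 < hub_dist x w <= j.+1) <-> near j y w.
  move=> Hj; rewrite /hub_dist -ball_full.
  by rewrite (bfs_dist (bfsP N_sym n.+1 y n) w Hj).
have /(HB _ d_le)/andP[D0 Dd] := near_d (hub_lt Hx) Hw.
case: (leqP i n) => Hi; first by rewrite -HB // D0.
split=> _; last by lia.
by apply: near_mono (near_d (hub_lt Hx) Hw); lia.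
Qed.

Lemma hub_dist_pos x w : x < size hubs -> w < n -> 0 < hub_dist x w.
Proof.
move=> Hx Hw; rewrite lt0n; have [Hu Hm Hmem _ _ _] := bfsP N_sym n.+1 (nth 0 hubs x) n.
rewrite /hub_dist Hm Hmem; apply/ball_full.
by apply: near_mono (near_d (hub_lt Hx) Hw).
Qed.

Lemma hub_dist_rep x w : x < size hubs -> w < n ->
  hub_dist x (nth 0 (reps n) (type_of n N l n w)) = hub_dist x w.
Proof.
move=> Hx Hw; have := @type_of_rep n N l n w Hw.
move/(congr1 (fun s => nth 0 s x)).
by rewrite /vec !(nth_map 0) ?size_iota // nth_iota.
Qed.

Lemma good_near k v w : v < n -> w < n ->
  good n N l k v w <-> exists x, x < size hubs /\ exists i j,
    [/\ i + j <= k, near i v (nth 0 hubs x) & near j (nth 0 hubs x) w].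
Proof.
move=> Hv Hw; rewrite /good /via; split.
- case/hasP=> x; rewrite mem_iota => /andP[_ Hx]; rewrite hub_dist_rep // => H.
  (* Both marks are positive, so taking 1 off each turns the bound [k.+2] into [k]. *)
  exists x; split=> //; exists (hub_dist x v).-1, (hub_dist x w).-1.
  have Pv := hub_dist_pos Hx Hv; have Pw := hub_dist_pos Hx Hw.
  split; first by lia.
    by apply: near_sym; apply/hub_dist_near; rewrite ?prednK.
  by apply/hub_dist_near; rewrite ?prednK.
- case=> x [Hx [i [j [Hij /near_sym/(hub_dist_near i Hx Hv) Hi /(hub_dist_near j Hx Hw) Hj]]]].
  apply/hasP; exists x; first by rewrite mem_iota.
  by rewrite hub_dist_rep //; lia.
Qed.

(* A shortest path either avoids all hubs or splits at one of them. *)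
Lemma covered_near k v w : v < n -> w < n ->
  good n N l k v w || ball N l v k w <-> near k v w.
Proof.
move=> Hv Hw; split.
- case/orP=> [/(good_near k Hv Hw)[x [_ [i [j [Hij Hi Hj]]]]]|/ballP[p [? ? ? _]]].
    exact: near_mono Hij (near_trans Hi Hj).
  by exists p.
- case=> p [Hp Hl Hs].
  case: (boolP (all (fun u => deg u < l) (v :: p))) => Ha.
    by apply/orP; right; apply/ballP; exists p.
  apply/orP; left; apply/good_near => //.
  case/allPn: Ha => y yp; rewrite -leqNgt => Hy.
  have : exists p1 p2, p = p1 ++ p2 /\ last v p1 = y.
    move: yp; rewrite inE => /orP[/eqP ->|/splitPr[p1 p2]]; first by exists [::], p.
    by exists (rcons p1 y), p2; rewrite cat_rcons last_rcons.
  case=> p1 [p2 [Ep Ey]]; move: Hp Hl Hs; rewrite Ep cat_path last_cat size_cat Ey.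
  case/andP=> Hp1 Hp2 Hl Hs.
  have N1 : near (size p1) v y by exists p1.
  have N2 : near (size p2) y w by exists p2.
  have Hyn := near_lt Hv N1.
  have Hh : y \in hubs by rewrite mem_filter Hy mem_iota.
  exists (index y hubs); rewrite index_mem Hh; split=> //.
  by exists (size p1), (size p2); rewrite nth_index.
Qed.

Lemma all_covered_near k : all_covered n N l k n <-> forall v w, v < n -> w < n -> near k v w.
Proof.
split=> [/allP H v w Hv Hw|H].
  have /allP Hc : covered n N l k v by apply: H; rewrite mem_iota.
  by apply/covered_near => //; apply: Hc; rewrite mem_iota.
apply/allP => v; rewrite mem_iota => /andP[_ Hv].
apply/allP => w; rewrite mem_iota => /andP[_ Hw].
by apply/covered_near => //; apply: H.
Qed.

Fixpoint words (A : seq nat) (m : nat) : seq (seq nat) :=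
  if m is m'.+1 then [seq a :: s | a <- A, s <- words A m'] else [:: [::]].

Lemma size_words A m : size (words A m) = size A ^ m.
Proof. by elim: m => //= m IH; rewrite size_allpairs IH expnS. Qed.

Lemma mem_words A s : {subset s <= A} -> s \in words A (size s).
Proof.
elim: s => //= a s IH H; apply/allpairsP; exists (a, s) => /=.
split=> //; first by apply: H; rewrite mem_head.
by apply: IH => x xs; apply: H; rewrite inE xs orbT.
Qed.

(* Distances from hubs to a non-hub lie between 1 and [d]. *)
Lemma size_reps_le : size (reps n) <= d ^ size hubs + size hubs.
Proof.
have -> : size (reps n) = size (map (vec n N l) (reps n)) by rewrite size_map.
(* Marks are distances plus 1, so the vector of a non-hub is a word over [2, ..., d + 1]. A hub has
   mark 1 for itself; the vectors of hubs are therefore counted separately. *)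
have -> : d ^ size hubs + size hubs
    = size (words (iota 2 d) (size hubs) ++ map (vec n N l) hubs).
  by rewrite size_cat size_words size_iota size_map.
apply: uniq_leq_size; first exact: reps_uniq.
move=> s /mapP[u /reps_lt Hu ->]; rewrite mem_cat.
case: (boolP (u \in hubs)) => Hh; first by rewrite map_f ?orbT.
apply/orP; left; have Es : size hubs = size (vec n N l u) by rewrite size_map size_iota.
rewrite [X in words _ X]Es; apply: mem_words => a /mapP[x].
rewrite mem_iota => /andP[_ Hx] ->.
have H1 : hub_dist x u <= d.+1 by apply/(hub_dist_near d Hx Hu)/near_d => //; apply: hub_lt.
have H0 := hub_dist_pos Hx Hu.
rewrite mem_iota; suff : hub_dist x u <> 1 by lia.
move=> E; have : near 0 (nth 0 hubs x) u by apply/(hub_dist_near 0 Hx Hu); rewrite E.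
case=> p [_ Hl]; rewrite leqn0 => /nilP Ep; move: Hl; rewrite Ep /= => Eu.
by move: Hh; rewrite -Eu mem_nth.
Qed.

End Distances.

(** * Running time *)

Lemma total_cost_le n m d h l nh r K : 1 < n -> 0 < h -> 0 < d -> l <= h.+1 ->
  nh <= h -> r <= d ^ nh + nh -> (d = 1 -> nh = 0) ->
  K = r * (20 * nh + 40) + 80 * (d.+1 * h ^ d) + 10 * d + 60 ->
  l * (20 * n + 20) + (20 * n + nh * (30 * (n + 2 * m) + 10 * n + 50)
    + n * (r * (20 * nh + 20) + 30) + d.+1 * (n * (K + 4) + 20) + 40)
  <= 1000 * time_bound n m d h.
Proof.
move=> n1 h0 d0 lh nhh Hr Hd1 HK; rewrite /time_bound.
set Z := d ^ h * h ^ d.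
have dh0 : 0 < d ^ h by rewrite expn_gt0 d0.
have hd0 : 0 < h ^ d by rewrite expn_gt0 h0.
have hhd : h <= h ^ d by rewrite -{1}(expn1 h) leq_pexp2l.
have ddh : d <= d ^ h by rewrite -{1}(expn1 d) leq_pexp2l.
have Z1 : d ^ h <= Z by rewrite leq_pmulr.
have Z2 : h ^ d <= Z by rewrite leq_pmull.
have Z3 : d * h ^ d <= Z by rewrite leq_mul2r ddh orbT.
have Z4 : d ^ h * h <= Z by rewrite leq_mul2l hhd orbT.
have dnh : d ^ nh <= d ^ h by rewrite leq_pexp2l.
(* This term comes from the at most [nh] additional types of the hubs, each of which is handled in
   O(h) steps. *)
have Z5 : nh * h <= Z.
  case: (ltnP 1 d) => Hd; last by rewrite Hd1 ?mul0n; lia.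
  have H2 : h ^ 2 <= h ^ d by rewrite leq_pexp2l.
  apply: leq_trans Z2; apply: leq_trans H2; by rewrite -mulnn leq_mul2r nhh orbT.
have R1 : r * h <= 2 * Z.
  apply: (@leq_trans ((d ^ h + nh) * h)); first by rewrite leq_mul2r; lia.
  by rewrite mulnDl; lia.
have R2 : r * (20 * nh + 40) <= 120 * Z.
  apply: (@leq_trans (r * (60 * h))); first by apply: leq_mul => //; lia.
  by rewrite mulnCA; lia.
have R3 : r * (20 * nh + 20) <= 120 * Z.
  by apply: leq_trans R2; rewrite leq_mul2l leq_add2l orbT.
have KZ : K <= 350 * Z by rewrite HK mulSn; lia.
have Z0 : 0 < Z by lia.
clearbody Z; clear HK Z1 Z2 Z3 Z4 Z5 dnh dh0 hd0 hhd ddh R1 R2 Hr Hd1.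
have nZ : n <= n * Z by rewrite leq_pmulr.
have ndZ : n * Z <= n * d * Z by rewrite leq_mul2r leq_pmulr ?orbT.
have T1 : n * (K + 4) + 20 <= 374 * (n * Z).
  have : n * (K + 4) <= n * (354 * Z) by apply: leq_mul => //; lia.
  by rewrite mulnCA; lia.
have T2 : d.+1 * (n * (K + 4) + 20) <= 748 * (n * d * Z).
  apply: (@leq_trans (2 * d * (374 * (n * Z)))); first by apply: leq_mul => //; lia.
  lia.
have T3 : n * (r * (20 * nh + 20) + 30) <= 150 * (n * d * Z).
  apply: (@leq_trans (n * (150 * Z))); first by apply: leq_mul => //; lia.
  by rewrite mulnCA leq_mul2l ndZ orbT.
have hn : n <= h * n by rewrite leq_pmull.
have T4 : l * (20 * n + 20) <= 80 * (h * n).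
  apply: (@leq_trans (2 * h * (40 * n))); first by apply: leq_mul; lia.
  lia.
have T5 : nh * (30 * (n + 2 * m) + 10 * n + 50) <= h * (90 * n + 60 * m).
  by apply: leq_mul => //; lia.
rewrite mulnDr; lia.
Qed.

Section Total.

Variables (n : nat) (N : nat -> seq nat).
Hypothesis n_pos : 0 < n.
Hypothesis N_sym : forall u w, (w \in N u) = (u \in N w).
Hypothesis N_lt : forall u w, w \in N u -> w < n.
Hypothesis N_uniq : forall u, uniq (N u).
Hypothesis N_irr : forall u, u \notin N u.
Notation deg u := (size (N u)).

Variables (adr M0 : nat -> nat) (B0 : nat).
Hypothesis M0_n : M0 0 = n.
Hypothesis M0_start : forall u, u <= n -> M0 u.+1 = adr u.
Hypothesis adr_next : forall u, u < n -> adr u.+1 = adr u + deg u.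
Hypothesis adr_last : adr n = B0.
Hypothesis M0_adj : forall u i, u < n -> i < deg u -> M0 (adr u + i) = nth 0 (N u) i.
Hypothesis B0_start : n.+1 < B0.
Hypothesis B0_adj : forall u i, u < n -> i < deg u -> adr u + i < B0.
Hypothesis M0_fresh : forall a, B0 <= a -> M0 a = 0.

Variables (m d h : nat).
Hypothesis m_sum : \sum_(0 <= u < n) deg u = 2 * m.
Hypothesis d_lt : d < n.
Hypothesis near_d : forall u w, u < n -> w < n -> near N d u w.
Hypothesis far_d : forall k, k < d -> exists u w, [/\ u < n, w < n & ~ near N k u w].
Hypothesis h_max : forall j, j <= n -> j <= cnt_ge n N j -> j <= h.

Lemma N_deg u : deg u <= n.
Proof.
rewrite -[X in _ <= X](size_iota 0 n); apply: uniq_leq_size => // w.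
by move/N_lt; rewrite mem_iota.
Qed.

Lemma deg_lt u : u < n -> deg u < n.
Proof.
move=> Hu; rewrite -[X in _ <= X](size_iota 0 n).
apply: (@uniq_leq_size _ (u :: N u)); first by rewrite /= N_irr N_uniq.
by move=> w; rewrite inE mem_iota => /orP[/eqP ->|/N_lt].
Qed.

(** Any two distinct vertices are then adjacent, so all degrees are equal and either no vertex is a
    hub or all are. *)
Lemma deg_complete u : d <= 1 -> u < n -> n <= (deg u).+1.
Proof.
move=> d1 Hu; rewrite -{1}(size_iota 0 n).
apply: (@uniq_leq_size _ _ (u :: N u)); first exact: iota_uniq.
move=> w; rewrite mem_iota inE => /andP[_ Hw].
have [p [Hp Hl Hs]] := near_d Hu Hw.
case: p Hp Hl Hs => [|y [|z p]] /= Hp Hl Hs; first by rewrite Hl eqxx.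
  by move: Hp; rewrite andbT /adj Hl => ->; rewrite orbT.
lia.
Qed.

Lemma all_covered_eq l k : k <= d -> all_covered n N l k n = (k == d).
Proof.
move=> Hk; case: (k =P d) => [->|Hne].
  by apply/(all_covered_near N_sym N_lt N_deg (ltnW d_lt) near_d).
apply/negP => /(all_covered_near N_sym N_lt N_deg (ltnW d_lt) near_d) H.
have [|u [w [Hu Hw Hn]]] := @far_d k; first by lia.
by apply: Hn; apply: H.
Qed.

(** [rz] is initially 0, so the first load reads [n]. Cell [n + 1] holds the end of the last list,
    the first free address, where row 0 begins. *)
Definition INIT : cmd :=
  Blk [:: IConst rone 1; IConst rtwo 2; ILoad rn rz; IAdd rT rn rone; ILoad bQ rT;
          IAdd bM bQ rn; IAdd bT bM rn; IAdd bR bT rn; IAdd bC bR rn;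
          IAdd bG bC rn; IAdd bD bG rn].

Definition DIAMETER : cmd := Seq INIT ALG.

Lemma diameter_spec :
  wp DIAMETER (fun=> 0) M0 (fun t R' M' =>
    t <= 1100 * (time_bound n m d h + 1) /\ R' rk = d).
Proof.
apply: wp_seq; apply: wp_blk; simpl; repeat rewrite updrE /=.
rewrite M0_n addn1 M0_start // adr_last.
set R0 := updr _ _ _.
have HE : env n B0 R0.
  by rewrite /env /R0 !updrE /= /row; do !split=> //; lia.
have HI : input M0 B0 M0 by [].
apply: wp_seq.
apply: (wp_mono (threshold_spec M0_start adr_next B0_start HE HI)).
move=> t1 R1 M1 HA1 [l [[-> Hrl l0 Ht1] [Hl1 Hl2]]].
have HE1 : env n B0 R1 by apply: (env_agree HA1).
have Hcnt j : cnt_ge n N j <= n by rewrite -[X in _ <= X](size_iota 0 n) count_size.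
have Hln : l.-1 <= n := leq_trans Hl1 (Hcnt _).
have Hlh : l.-1 <= h by apply: h_max.
have Hnh : size (hubs n N l) <= l.-1.
  by rewrite size_filter -/(cnt_ge n N l) -ltnS prednK.
pose r := size (reps n N l n); pose nh := size (hubs n N l).
have Hr : r <= d ^ nh + nh by apply: (@size_reps_le n N) => //; [exact: N_deg | exact: ltnW].
have Hrn : r <= n by apply: reps_size.
have Hsum : \sum_(0 <= u < n) (deg u).+1 = n + 2 * m.
  rewrite -m_sum (eq_bigr (fun u => 1 + deg u)) => [|u _]; last by rewrite add1n.
  by rewrite big_split /= sum_nat_const_nat subn0 muln1.
have Hfresh j i : i < n -> M0 (row n B0 j + i) = 0.
  by move=> _; apply: M0_fresh; rewrite /row; lia.
case: (ltnP 1 n) => n1.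
- have d0 : 0 < d.
    rewrite lt0n; apply/eqP => E; have [|p [_ Hl]] := @near_d 0 1 n_pos; first by [].
    by rewrite E leqn0 => /nilP Ep; move: Hl; rewrite Ep.
  have h0 : 0 < h.
    apply: h_max => //; rewrite -has_count; apply/hasP; exists 0; first by rewrite mem_iota.
    have [p [Hp Hl Hs]] := @near_d 0 1 n_pos n1.
    case: p Hp Hl Hs => //= y p /andP[Hy _] _ _.
    by move: Hy; rewrite /adj; case: (N 0).
  (* One hub would make all [n] vertices hubs, whereas their number is below [l] and [l] is at most
     a degree, hence below [n]. *)
  have Hd1 : d = 1 -> nh = 0.
    move=> E; case: (posnP nh) => // Hnh0.
    have Hx := mem_nth 0 Hnh0; rewrite mem_filter mem_iota in Hx.
    case/andP: Hx => Hx /andP[_ Hxn].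
    have Hlt := deg_lt Hxn.
    have : cnt_ge n N l = n.
      rewrite -[RHS](size_iota 0 n); apply/eqP; rewrite -all_count; apply/allP => w.
      rewrite mem_iota => /andP[_ Hw]; have := @deg_complete w; rewrite E => /(_ isT Hw).
      lia.
    lia.
  pose K := r * (20 * nh + 40) + 80 * (d.+1 * h ^ d) + 10 * d + 60.
  have HK k v : k <= d -> v < n -> check_cost n N l k v <= K.
    move=> Hk Hv; rewrite /check_cost -/r -/nh /K.
    have Hlh' : l <= h.+1 by lia.
    have W1 := work_ball_le N_sym k Hv h0 Hlh'.
    have W2 := ball_size_le N_sym k Hv h0 Hlh'.
    have W3 : k.+1 * h ^ k <= d.+1 * h ^ d by rewrite leq_mul // leq_pexp2l.
    lia.
  apply: (wp_mono (rest_spec N_sym N_lt M0_start adr_next M0_adj B0_start B0_adj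
    HE1 HI Hrl Hfresh (@all_covered_eq l) HK)).
  move=> t2 R2 M2 _ [Ht2 Hk2]; split=> //.
  rewrite Hsum -/nh -/r in Ht2.
  have Hlh' : l <= h.+1 by lia.
  have Hnhh : nh <= h by rewrite /nh; lia.
  have := @total_cost_le n m d h l nh r K n1 h0 d0 Hlh' Hnhh Hr Hd1 erefl.
  lia.
(* For a single vertex [d = 0] and [time_bound] may vanish; the additive 1 in the claimed bound then
   pays for the constant cost. *)
- have E1 : n = 1 by lia.
  have d0 : d = 0 by lia.
  have m0 : 2 * m = 0.
    rewrite -m_sum E1 big_nat1; have := @deg_lt 0 n_pos; lia.
  have HK k v : k <= d -> v < n -> check_cost n N l k v <= 140.
    move=> Hk Hv; have -> : k = 0 by lia.
    rewrite /check_cost -/r -/nh /work take0 big_nil.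
    have : size (bfs N l v 0).2.1 <= 1.
      rewrite -[X in _ <= X](size_iota 0 1); apply: uniq_leq_size.
        exact: bfs_uniq (bfsP N_sym l v 0).
      by move=> u /(bfs_lt N_sym N_lt Hv); rewrite mem_iota E1.
    have : r * (20 * nh + 40) <= 1 * (20 * 1 + 40).
      by apply: leq_mul; rewrite /nh; lia.
    lia.
  apply: (wp_mono (rest_spec N_sym N_lt M0_start adr_next M0_adj B0_start B0_adj
    HE1 HI Hrl Hfresh (@all_covered_eq l) HK)).
  move=> t2 R2 M2 _ [Ht2 Hk2]; split=> //.
  rewrite Hsum -/nh -/r in Ht2.
  have A1 : l * (20 * n + 20) <= 2 * 40 by apply: leq_mul; lia.
  have A2 : nh * (30 * (n + 2 * m) + 10 * n + 50) <= 1 * 90.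
    by apply: leq_mul; rewrite /nh; lia.
  have A3 : n * (r * (20 * nh + 20) + 30) <= 1 * (1 * 40 + 30).
    apply: leq_mul; first by lia.
    by rewrite leq_add2r; apply: leq_mul; rewrite /nh; lia.
  have A4 : d.+1 * (n * (140 + 4) + 20) <= 1 * 164 by apply: leq_mul; lia.
  lia.
Qed.

End Total.

(** * Adjacency list encoding *)

(** The estimates give [b <= k * X ^ 2] with [k = 24 * 2 ^ q + 2 * c]; as [X >= 2], the constant
    itself is at most [X ^ k] and moves into the exponent. *)
Lemma value_le X V q t n b c : 1 < X -> V <= 12 * X -> t <= c * X ->
  n <= X -> b <= 2 * (V * 2 ^ q + t * n) -> b <= X ^ (24 * 2 ^ q + 2 * c + 2).
Proof.
move=> X1 HV Ht Hn Hb; set k := 24 * 2 ^ q + 2 * c.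
have Hk : k <= X ^ k.
  by apply: leq_trans (ltnW (ltn_expl k (ltnSn 1))) _; case: (k) => // k'; rewrite leq_exp2r.
apply: (@leq_trans (k * X ^ 2)); last by rewrite expnD leq_mul2r Hk orbT.
apply: leq_trans Hb _; rewrite /k; move: (2 ^ q) => Q.
have H1 : V * Q <= 12 * X * Q by rewrite leq_mul2r HV orbT.
have H2 : t * n <= c * X * X by apply: leq_mul.
have H3 : X * Q <= X * X * Q by rewrite leq_mul2r leq_pmulr ?orbT //; lia.
rewrite -mulnn; lia.
Qed.

Section Encoding.

Variables (n : nat) (e : rel 'I_n) (L : 'I_n -> seq 'I_n).
Hypothesis graph : simple_graph e.
Hypothesis lists : adj_lists_of e L.

(** The algorithm is verified over natural numbers. Numbers that are not vertices get an empty list,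
    so symmetry of adjacency needs no range conditions. *)
Definition nbr (u : nat) : seq nat :=
  if insub u is Some x then [seq val w | w <- L x] else [::].

Lemma nbr_ord (x : 'I_n) : nbr x = [seq val w | w <- L x].
Proof. by rewrite /nbr valK. Qed.

Lemma mem_nbr u w : w \in nbr u ->
  exists x y : 'I_n, [/\ u = x, w = y & e x y].
Proof.
rewrite /nbr; case: insubP => // x _ <- /mapP[y yL ->].
by exists x, y; split=> //; rewrite -(lists x).2.
Qed.

Lemma nbr_adj (x y : 'I_n) : (val y \in nbr x) = e x y.
Proof. by rewrite nbr_ord mem_map ?(lists x).2 //; apply: val_inj. Qed.

Lemma nbr_sym u w : (w \in nbr u) = (u \in nbr w).
Proof.
by apply/idP/idP => /mem_nbr[x [y [-> -> He]]]; rewrite nbr_adj graph.1.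
Qed.

Lemma nbr_lt u w : w \in nbr u -> w < n.
Proof. by case/mem_nbr=> x [y [_ -> _]]. Qed.

Lemma nbr_uniq u : uniq (nbr u).
Proof.
rewrite /nbr; case: insubP => // x _ _; rewrite map_inj_uniq ?(lists x).1 //.
exact: val_inj.
Qed.

Lemma nbr_irr u : u \notin nbr u.
Proof.
apply/negP => /mem_nbr[x [y [-> /val_inj <-]]].
by rewrite graph.2.
Qed.

Lemma size_nbr (x : 'I_n) : size (nbr x) = deg e x.
Proof.
rewrite nbr_ord size_map /deg -(card_uniqP (lists x).1); apply: eq_card => w.
by rewrite inE (lists x).2.
Qed.

Lemma map_enum (T : Type) (f : nat -> T) : [seq f (val v) | v <- enum 'I_n] = map f (iota 0 n).
Proof. by rewrite -val_enum_ord -map_comp. Qed.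

Definition start (v : nat) : nat := n.+2 + \sum_(0 <= u < v) size (nbr u).

Lemma startS v : start v.+1 = start v + size (nbr v).
Proof. by rewrite /start big_nat_recr //= addnA. Qed.

Lemma start_mono i j : i <= j -> start i <= start j.
Proof. by move/subnK <-; elim: (j - i) => // k IH; rewrite addSn startS; lia. Qed.

Lemma encodeE : encode L =
  n :: map start (iota 0 n.+1) ++ flatten (map nbr (iota 0 n)).
Proof.
rewrite /encode; congr (_ :: _ ++ flatten _); last first.
  by rewrite -map_enum; apply: eq_map => v; rewrite nbr_ord.
apply/eq_in_map => k; rewrite mem_iota => /andP[_ Hk].
have -> : [seq size (L v) | v <- enum 'I_n] = [seq size (nbr u) | u <- iota 0 n].
  by rewrite -map_enum; apply: eq_map => v; rewrite nbr_ord size_map.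
rewrite -map_take take_iota (minn_idPl _); last by lia.
by rewrite sumnE big_map /start /index_iota subn0.
Qed.

Notation M0 := (fun i => nth 0 (encode L) i).

Lemma size_flat v : size (flatten (map nbr (iota 0 v))) = \sum_(0 <= u < v) size (nbr u).
Proof. by rewrite size_flatten /shape -map_comp sumnE big_map /index_iota subn0. Qed.

Lemma encode_start u : u <= n -> M0 u.+1 = start u.
Proof.
move=> Hu; rewrite encodeE -cat1s nth_cat ltnNge subSS subn0 nth_cat size_map size_iota ltnS Hu.
by rewrite (nth_map 0) ?size_iota // nth_iota.
Qed.

Lemma encode_tail i : M0 (n.+2 + i) = nth 0 (flatten (map nbr (iota 0 n))) i.
Proof.
rewrite encodeE -cat1s catA nth_cat size_cat size_map size_iota add1n.
by rewrite ltnNge leq_addr addKn.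
Qed.

Lemma encode_nbr u i : u < n -> i < size (nbr u) -> M0 (start u + i) = nth 0 (nbr u) i.
Proof.
move=> Hu Hi; rewrite /start -addnA encode_tail.
have -> : iota 0 n = iota 0 u ++ u :: iota u.+1 (n - u.+1).
  by have {1}-> : n = u + (n - u.+1).+1; [lia | rewrite iotaD].
rewrite map_cat flatten_cat nth_cat size_flat ltnNge leq_addr /= addKn.
by rewrite nth_cat Hi.
Qed.

Lemma encode_fresh a : start n <= a -> M0 a = 0.
Proof.
move=> Ha; rewrite -(subnKC (leq_trans (leq_addr _ _) Ha)) encode_tail nth_default //.
by rewrite size_flat; move: Ha; rewrite /start; lia.
Qed.

Lemma encode_le i : M0 i <= start n.
Proof.
have H : all (fun x => x <= start n) (encode L).
  rewrite encodeE -cat1s !all_cat all_seq1; apply/and3P; split; first by rewrite /start; lia.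
    apply/allP => x /mapP[u]; rewrite mem_iota => /andP[_ Hu] ->.
    by apply: start_mono; lia.
  apply/allP => x /flatten_mapP[u _ /nbr_lt]; rewrite /start; lia.
case: (ltnP i (size (encode L))) => Hi; last by rewrite nth_default.
exact: (all_nthP 0 H).
Qed.

Lemma handshake : \sum_(0 <= u < n) size (nbr u) = 2 * num_edges e.
Proof.
rewrite big_mkord (eq_bigr (fun x : 'I_n => \sum_(y : 'I_n) e x y)); last first.
  by move=> x _; rewrite size_nbr /deg -sum1dep_card big_mkcond.
pose T := \sum_(x : 'I_n) \sum_(y : 'I_n) ((x < y) && e x y).
have E1 : num_edges e = T.
  rewrite /num_edges -sum1dep_card big_mkcond /T pair_big /=.
  by apply: eq_bigr => p _; case: (_ && _).
have E2 : \sum_(x : 'I_n) \sum_(y : 'I_n) ((y < x) && e x y) = T.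
  rewrite exchange_big; apply: eq_bigr => x _; apply: eq_bigr => y _.
  by rewrite graph.1.
rewrite mul2n -addnn E1 -{1}E2 /T addnC -big_split; apply: eq_bigr => x _.
rewrite -big_split; apply: eq_bigr => y _ /=.
case: ltngtP => [| |/val_inj ->]; rewrite /= ?addn0 ?graph.2 //.
Qed.

Lemma cnt_geE j : cnt_ge n nbr j = #|[set v | j <= deg e v]|.
Proof.
rewrite /cnt_ge cardsE cardE /enum_mem size_filter -enumT -val_enum_ord count_map.
by apply: eq_count => x; rewrite [LHS]/= size_nbr.
Qed.

Lemma hindex_max j : j <= n -> j <= cnt_ge n nbr j -> j <= hindex e.
Proof.
rewrite cnt_geE -ltnS => Hj Hc.
exact: (@leq_bigmax_cond _ _ _ (Ordinal Hj)).
Qed.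

Lemma path_nbr (x : 'I_n) (p : seq 'I_n) :
  path e x p -> path (adj nbr) x (map val p).
Proof.
by elim: p x => //= y p IH x /andP[He /IH ->]; rewrite /adj nbr_adj He.
Qed.

Lemma nbr_path (x : 'I_n) p : path (adj nbr) x p ->
  exists q : seq 'I_n, p = map val q /\ path e x q.
Proof.
elim: p x => [|y p IH] x /=; first by exists [::].
case/andP=> /mem_nbr[x' [y' [/val_inj <- -> He]]] /IH[q [-> Hq]].
by exists (y' :: q); rewrite /= He.
Qed.

Lemma near_ord k (x y : 'I_n) : near nbr k x y <->
  exists p, path e x p /\ last x p = y /\ size p <= k.
Proof.
split=> [[p [/nbr_path[q [-> Hq]]]]|[p [Hp [Hl Hs]]]].
  by rewrite last_map size_map => /val_inj Hl Hs; exists q.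
exists (map val p); split; first exact: path_nbr.
  by rewrite last_map Hl.
by rewrite size_map.
Qed.

End Encoding.

(** * The program, its running time and its values *)

Definition diameter_program : program := rcons (compile 0 DIAMETER) IHalt.

(** The program is closed, so the condition is checked by computation; past its end [nth] yields
    [IHalt], which satisfies it. The number 11 is the length of [INIT]. *)
Lemma diameter_program_grow i : 11 <= i -> grow_ok 11 (nth IHalt diameter_program i).
Proof.
move=> Hi; have H : all (grow_ok 11) (drop 11 diameter_program) by vm_compute.
rewrite -(subnKC Hi) -nth_drop.
case: (ltnP (i - 11) (size (drop 11 diameter_program))) => Hs; last by rewrite nth_default.
exact: (all_nthP IHalt H).
Qed.

Theorem theorem6 :
  exists (P : program) (c : nat),
  forall (n : nat) (e : rel 'I_n) (L : 'I_n -> seq 'I_n) (d : nat),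
    0 < n -> simple_graph e -> connected_graph e ->
    adj_lists_of e L -> is_diameter e d ->
    let B := time_bound n (num_edges e) d (hindex e) in
    exists t : nat,
      t <= c * (B + 1) /\
      halted P (run P t (init_state (encode L))) /\
      reg (run P t (init_state (encode L))) 0 = d /\
      (forall t', t' <= t ->
         values_bounded (run P t' (init_state (encode L)))
                        ((B + n + num_edges e + 2) ^ c)).
Proof.
(* The exponent of [value_le] for [q = 11], the length of the initialisation, and [c = 1100], the
   time constant of [diameter_spec]; being larger than 1100 it serves for the time as well. *)
exists diameter_program, (24 * 2 ^ 11 + 2 * 1100 + 2).
move=> n e L d n0 Hg Hconn HL [Hd1 Hd2] B.
have d_lt : d < n.
  have [u [v H]] := Hd2.
  have [p Hp Ev] := connectP (Hconn u v); rewrite Ev in H.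
  case/shortenP: Hp H {Ev} => q Hq Uq _ /(_ q Hq erefl) Hle.
  apply: leq_ltn_trans Hle _; have := max_card (mem (u :: q)).
  by rewrite (card_uniqP Uq) card_ord.
have [t [R [M [Hex [Ht HR]]]]] : wp DIAMETER (fun=> 0) (fun i => nth 0 (encode L) i)
    (fun t R' M' => t <= 1100 * (B + 1) /\ R' rk = d).
  apply: (@diameter_spec n (nbr L) n0 (nbr_sym Hg HL) (nbr_lt HL) (nbr_uniq HL)
    (nbr_irr Hg HL) (start L) _ (start L n)).
  - by rewrite encodeE.
  - exact: encode_start.
  - by move=> u _; apply: startS.
  - by [].
  - exact: encode_nbr.
  - rewrite /start; lia.
  - move=> u i Hu Hi; apply: (@leq_trans (start L u.+1)); first by rewrite startS ltn_add2l.
    exact: start_mono.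
  - exact: encode_fresh.
  - exact: handshake.
  - exact: d_lt.
  - move=> u w Hu Hw; apply/(near_ord HL d (Ordinal Hu) (Ordinal Hw)).
    exact: Hd1.
  - move=> k Hk; have [u [v H]] := Hd2; exists u, v; split=> //.
    case/(near_ord HL) => p [Hp [Hl Hs]]; have := H p Hp Hl; lia.
  - move=> j; exact: hindex_max.
pose s0 := init_state (encode L).
have code0 : code_at diameter_program 0 (compile 0 DIAMETER).
  by move=> i Hi; rewrite add0n /diameter_program nth_rcons Hi.
have Hrun : run diameter_program t s0 = St (clen DIAMETER) R M.
  exact: (compile_correct Hex).
exists t; split; first by apply: leq_trans Ht _; rewrite leq_mul2r; lia.
split; first by rewrite Hrun /halted /step -(size_compile 0) /diameter_program nth_rcons ltnn eqxx.
split; first by rewrite Hrun.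
move=> t' Ht'.
set X := B + n + num_edges e + 2.
(* The largest input value is the end address [n + 2 + 2 * num_edges e]; the other 10 in [V] cover
   the constants of the program. *)
pose V := n + 2 * num_edges e + 12.
have HV0 : values_bounded s0 V.
  split=> i //=; apply: leq_trans (encode_le HL i) _.
  by rewrite /start (handshake Hg HL) /V; lia.
have HX : 1 < X by rewrite /X; lia.
have HVX : V <= 12 * X by rewrite /V /X; lia.
have HnX : n <= X by rewrite /X; lia.
have HtX : t' <= 1100 * X by rewrite /X; lia.
(* During the initialisation [rn] and [rone] are still being set, so only the doubling bound
   applies; over 11 steps it costs a constant factor. *)
case: (leqP t' 11) => H11.
  have [H1 H2] : values_bounded (run diameter_program t' s0) (V * 2 ^ t').
    by apply: bounded_run => //; rewrite /V; lia.
  have Hle : V * 2 ^ t' <= V * 2 ^ 11 by rewrite leq_mul2l leq_exp2l // H11 orbT.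
  have Hb b : b <= V * 2 ^ t' -> b <= X ^ (24 * 2 ^ 11 + 2 * 1100 + 2).
    move=> Hb; apply: (@value_le X V 11 t' n) => //.
    by apply: leq_trans Hb (leq_trans Hle _); rewrite mulnDr mul2n -addnn -addnA leq_addr.
  by split=> i; apply: Hb.
pose pre := if INIT is Blk l then l else [::].
have Hpre : run diameter_program 11 s0 =
    St 11 (exblk pre (fun=> 0, fun i => nth 0 (encode L) i)).1
          (exblk pre (fun=> 0, fun i => nth 0 (encode L) i)).2.
  apply: (@run_blk diameter_program 0 pre) => //.
  by have /code_at_cat[] : code_at diameter_program 0 (pre ++ compile 11 ALG).
have [HB1 HB2] : values_bounded (run diameter_program 11 s0) (V * 2 ^ 11).
  by apply: bounded_run => //; rewrite /V; lia.
(* From here on [rn = n] and [rone = 1], so no increment exceeds [n]. *)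
have Hgr : grown 11 n (V * 2 ^ 11) (run diameter_program 11 s0).
  split.
  - by rewrite Hpre.
  - by rewrite Hpre /= encodeE.
  - by move=> r _; apply: HB1.
  - by apply: leq_trans (HB1 _) _; rewrite leq_pmull.
  - exact: HB2.
have V10 : 10 <= V * 2 ^ 11.
  by apply: (@leq_trans V); [rewrite /V; lia | rewrite leq_pmulr // expn_gt0].
have := grown_run (t' - 11) diameter_program_grow V10 Hgr.
rewrite -runD subnKC; last exact: ltnW.
case=> _ _ H1 H2 H3.
have Hb b : b <= 2 * (V * 2 ^ 11 + (t' - 11) * n) -> b <= X ^ (24 * 2 ^ 11 + 2 * 1100 + 2).
  move=> Hb; apply: (@value_le X V 11 (t' - 11) n) => //.
  by apply: leq_trans (leq_subr _ _) HtX.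
have Hone b : b <= V * 2 ^ 11 + (t' - 11) * n -> b <= X ^ (24 * 2 ^ 11 + 2 * 1100 + 2).
  by move=> H; apply: Hb; apply: leq_trans H _; rewrite leq_pmull.
split=> i; last exact: Hone.
by case: (i =P rT) => [->|/eqP Hi]; [apply: Hb | apply: Hone; apply: H1].
Qed.
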